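(* Let $p$ be a prime with $p \neq 2, 3$ and let $G$ be a finite $p$-group of order $p^n$ and nilpotency class $c \geq 3$. Let $d = d(G)$, let $\delta = d(G/Z(G))$, let $|G^{ab}| = p^m$, and let $p^e$ be the exponent of $G^{ab}$. Then $$|\mathcal{M}(G)| \leq p^{\frac{d(m-e)}{2} + (\delta-1)(n-m) - \max(0,\delta-2) - \max(1,\delta-3)}.$$
   Context: For a group $H$, $d(H)$ denotes the cardinality of a minimal generating set of $H$, $Z(H)$ its center, and $H^{ab}$ its abelianization. $\mathcal{M}(G)$ denotes the Schur multiplier of $G$, i.e. the second integral homology group $H_2(G,\mathbb{Z})$ with $G$ acting trivially on $\mathbb{Z}$. *)

(* Defs.v *)
(* MathComp, with MathComp-Analysis for sets and real powers *)
From HB Require Import structures.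
From mathcomp Require Import all_boot all_order all_algebra.
From mathcomp Require Import all_fingroup all_solvable finmap.
From mathcomp Require Import mathcomp_extra boolp classical_sets functions.
From mathcomp Require Import cardinality reals exp.
From mathcomp Require Import ring.

Set Implicit Arguments.
Unset Strict Implicit.
Unset Printing Implicit Defensive.

Import Order.TTheory GRing.Theory Num.Theory.
Local Open Scope ring_scope.

(* The free abelian group on a finite type X. *)
Notation chain X := {ffun X -> int}.

Definition chain1 (X : finType) (x : X) : chain X := [ffun y => (y == x)%:R].

(* The homomorphism of free abelian groups sending the generator x to f x. *)
Definition chain_ext (X Y : finType) (f : X -> chain Y) (w : chain X)
    : chain Y := \sum_x f x *~ w x.

Section SecondHomology.
Variable gT : finGroupType.

(* The inhomogeneous bar complex of gT with trivial coefficients Z, in degrees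
   1, 2 and 3: [g|h] is chain1 (g, h), and [g|h|k] is chain1 (g, h, k). *)
Definition bar_d2 : chain (gT * gT)%type -> chain gT :=
  chain_ext (fun t : gT * gT => let: (g, h) := t in
    chain1 h - chain1 (g * h)%g + chain1 g).

Definition bar_d3 : chain (gT * gT * gT)%type -> chain (gT * gT)%type :=
  chain_ext (fun t : gT * gT * gT => let: (g, h, k) := t in
    chain1 (h, k) - chain1 ((g * h)%g, k) + chain1 (g, (h * k)%g)
      - chain1 (g, h)).

Definition cycles2 : set (chain (gT * gT)%type) :=
  [set z | bar_d2 z = 0]%classic.

Definition boundaries2 : set (chain (gT * gT)%type) := range bar_d3.

(* H_2(gT, Z), as the set of cosets of boundaries2 in cycles2. *)
Definition H2 : set (set (chain (gT * gT)%type)) :=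
  [set [set z + b | b in boundaries2] | z in cycles2]%classic.

End SecondHomology.

Arguments cycles2 : clear implicits.
Arguments boundaries2 : clear implicits.
Arguments H2 : clear implicits.

Definition schur_multiplier (gT : finGroupType) (G : {group gT}) :=
  H2 (subg_of G).

Arguments schur_multiplier {gT} G.

(* Checks on the definitions: the bar differentials compose to 0, and H2 is
   finite, so that fset_set (H2 gT) does enumerate H2 gT. *)
Section Sanity.

Lemma chain_ext_is_zmod_morphism (X Y : finType) (f : X -> chain Y) :
  zmod_morphism (chain_ext f).
Proof.
move=> u v; rewrite /chain_ext -sumrB; apply: eq_bigr => x _.
by rewrite !ffunE mulrzBr.
Qed.

HB.instance Definition _ (X Y : finType) (f : X -> chain Y) :=
  GRing.isZmodMorphism.Build (chain X) (chain Y) (chain_ext f)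
    (chain_ext_is_zmod_morphism f).

Lemma chain_ext1 (X Y : finType) (f : X -> chain Y) (x : X) :
  chain_ext f (chain1 x) = f x.
Proof.
rewrite /chain_ext (bigD1 x) //= ffunE eqxx mulr1z big1 ?addr0 // => y /negPf.
by rewrite ffunE => ->; rewrite mulr0z.
Qed.

Lemma chain_ext_id (X : finType) (w : chain X) : chain_ext (@chain1 X) w = w.
Proof.
apply/ffunP => y; rewrite /chain_ext sum_ffunE (bigD1 y) //=.
rewrite big1 => [|x /negPf].
  by rewrite addr0 ffunMzE ffunE eqxx -mulrzr mul1r intz.
by move=> yx; rewrite ffunMzE ffunE eq_sym yx mul0rz.
Qed.

Lemma raddf_chain_ext (X Y : finType) (V : zmodType) (f : X -> chain Y)
    (u : {additive chain Y -> V}) w :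
  u (chain_ext f w) = \sum_x u (f x) *~ w x.
Proof. by rewrite raddf_sum; apply: eq_bigr => x _; rewrite raddfMz. Qed.

Variable gT : finGroupType.

HB.instance Definition _ :=
  GRing.isZmodMorphism.Build _ _ (@bar_d2 gT) (chain_ext_is_zmod_morphism _).
HB.instance Definition _ :=
  GRing.isZmodMorphism.Build _ _ (@bar_d3 gT) (chain_ext_is_zmod_morphism _).

Lemma bar_d2_1 (g h : gT) :
  bar_d2 (chain1 (g, h)) = chain1 h - chain1 (g * h)%g + chain1 g.
Proof. exact: chain_ext1. Qed.

Lemma bar_d3_1 (g h k : gT) :
  bar_d3 (chain1 (g, h, k)) =
  chain1 (h, k) - chain1 ((g * h)%g, k) + chain1 (g, (h * k)%g)
    - chain1 (g, h).
Proof. exact: chain_ext1. Qed.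

Lemma bar_d2_d3 w : bar_d2 (@bar_d3 gT w) = 0.
Proof.
rewrite {1}/bar_d3 [bar_d2 _]raddf_chain_ext big1 // => -[[g h] k] _.
rewrite !(raddfB, raddfD) /= !bar_d2_1 mulgA.
have -> : forall a b c d e f : chain gT,
    (c - e + b) - (c - f + d) + (e - f + a) - (b - d + a) = 0.
  by move=> *; apply/ffunP => x; rewrite !ffunE; ring.
by rewrite mul0rz.
Qed.

Lemma bar_homotopy (z : chain (gT * gT)%type) : bar_d2 z = 0 ->
  exists w, bar_d3 w = z *~ #|gT|.
Proof.
move=> z0.
pose S := chain_ext (fun g : gT => \sum_(k : gT) chain1 (g, k)).
pose K := chain_ext (fun t : gT * gT => \sum_(k : gT) chain1 (t, k)).
have S1 x : S (chain1 x) = \sum_(k : gT) chain1 (x, k) by exact: chain_ext1.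
suff E : S (bar_d2 z) - bar_d3 (K z) = z *~ #|gT|.
  by exists (- K z); rewrite -E z0 raddfN /S raddf0 sub0r.
rewrite -{3}(chain_ext_id z) [chain_ext (@chain1 _) z]/chain_ext mulrz_suml.
rewrite [S _]raddf_chain_ext [bar_d3 _]raddf_chain_ext -sumrB.
apply: eq_bigr => -[g h] _.
rewrite -mulrzBl mulrzAC; congr (_ *~ _).
rewrite raddfD raddfB /= -/S !S1 [bar_d3 _]raddf_sum.
rewrite (eq_bigr _ (fun k _ => bar_d3_1 g h k)).
rewrite sumrB big_split /= sumrB.
have -> : \sum_(k : gT) chain1 (g, (h * k)%g) = \sum_(k : gT) chain1 (g, k).
  by rewrite [RHS](reindex_inj (mulgI h)).
rewrite sumr_const -pmulrn.
by apply/ffunP => x; rewrite !ffunE; ring.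
Qed.

Lemma H2_finite : finite_set (H2 gT).
Proof.
pose n := #|gT|.
have n_gt0 : (0 < n)%N by apply/card_gt0P; exists 1%g.
pose red (z : chain (gT * gT)%type) : {ffun gT * gT -> 'I_n} :=
  [ffun x => insubd (Ordinal n_gt0) `|(z x %% n%:Z)%Z|%N].
pose coset (z : chain (gT * gT)%type) :=
  [set z + b | b in boundaries2 gT]%classic.
pose rep f := xget 0 [set z | cycles2 gT z /\ red z = f]%classic.
apply: (sub_finite_set (B :=
   [set coset (rep f) | f in [set: {ffun gT * gT -> 'I_n}]]%classic)).
  2: exact/finite_image/finite_finset.
move=> _ [z Zz <-]; exists (red z) => //.
have [Zr] : cycles2 gT (rep (red z)) /\ red (rep (red z)) = red z.
  apply: (@xgetPex _ 0 [set y | cycles2 gT y /\ red y = red z]%classic).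
  by exists z.
move: (rep _) Zr => r Zr rz.
have n0 : n%:Z != 0 by rewrite eqz_nat -lt0n.
have [y zE] : exists y, r - z = y *~ n.
  exists [ffun x => ((r x - z x) %/ n%:Z)%Z]; apply/ffunP => x.
  rewrite ffunMzE !ffunE -mulrzr intz divzK //.
  move/ffunP/(_ x): rz; rewrite !ffunE => /(congr1 val).
  have lt u : (`|(u %% n%:Z)%Z| < n)%N.
    by rewrite -ltz_nat gez0_abs ?modz_ge0 // ltz_pmod.
  rewrite !val_insubd !lt => /(congr1 Posz); rewrite !gez0_abs ?modz_ge0 //.
  by move/eqP; rewrite eqz_mod_dvd.
have y0 : bar_d2 y = 0.
  have : bar_d2 y *~ n = 0 by rewrite -raddfMz -zE raddfB /= Zr Zz subrr.
  move/ffunP => yn; apply/ffunP => x; move: (yn x); rewrite ffunMzE !ffunE.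
  by move/eqP; rewrite mulrz_eq0 (negPf n0) /= => /eqP.
have [w wE] := bar_homotopy y0.
have -> : r = z + bar_d3 w by rewrite wE -zE addrC subrK.
apply/seteqP; split=> _ [_ [v _ <-] <-] /=.
  by exists (bar_d3 (w + v)); [exists (w + v) | rewrite raddfD addrA].
exists (bar_d3 (v - w)); first by exists (v - w).
by rewrite raddfB /= addrA addrAC addrK addrC.
Qed.

End Sanity.

(* Main.v *)
From HB Require Import structures.
Require Import Defs.
From mathcomp Require Import all_boot all_order all_algebra.
From mathcomp Require Import all_fingroup all_solvable finmap.
From mathcomp Require Import boolp classical_sets cardinality reals exp.
From mathcomp Require Import ring zify.

Set Implicit Arguments.
Unset Strict Implicit.
Unset Printing Implicit Defensive.

(** The multiplier is traded for a subgroup of a finite group. Let A be the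
    group of bar 2-chains of G modulo boundaries and modulo |G|. The symbols
    [g|h] form a 2-cocycle with values in A, hence a finite central extension
    pi : E -> G with kernel A. As |G| kills H_2(G, Z), reducing chains modulo
    |G| stays injective on H_2; and since [g|h] = s(g) s(h) s(gh)^-1 for the
    canonical section s, the class of a chain z in the abelianization of E
    only depends on the bar differential of z, so that cycles land in E'
    (ext_inj_cycle_der1). Hence |M(G)| <= |E' :&: ker pi| = |E'| / |G'|, and
    it remains to bound |E'| for a p-group E that is a central extension of G.

    This is done one factor of the lower central series of E at a time.

    - L_2(E) / L_3(E) is a quotient of the exterior square of G / G'. A basis
      of G / G' of orders o_1 >= ... >= o_r gives generators of orders at most
      min (o_i, o_j), and min (a, b)^2 <= a b bounds their product by
      (|G / G'| / o_1)^(r/2), which is the term d (m - e) / 2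
      (card_lcn2_bound).

    - Let Y be the preimage of Z(G). By the three subgroups lemma E' commutes
      with Y. So, for i >= 2, the commutator map from L_i(E) x E onto
      L_(i+1)(E) / L_(i+2)(E) only sees E through delta generators x_1, ...,
      x_delta of E modulo Y, and L_i(E) through L_i(G) / L_(i+1)(G). This
      gives |L_(i+1)(E) : L_(i+2)(E)| <= |L_i(G) : L_(i+1)(G)|^delta, and
      altogether the factor |G'|^delta.

    - The commutators [k, x_j] satisfy relations coming from the Jacobi
      identity. Adding the x_j one after the other, each x_j for which some
      [k, x_j] with nontrivial k is already known saves a factor p
      (card_commg_gain). With k = [x_1, x_2] all generators but two are saved
      for i = 2 (card_lcn3_gain). For i = 3, k = [x_1, x_2, x_3] saves all but
      three (card_lcn4_gain), and one saving is always possible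
      (card_lcn4_gain1): if all [x, y, x] vanish, a generator is saved unless
      every [x, y, z] is invariant under rotation, and the Jacobi identity
      then reads 3 [x, y, z] = 0, which is where p <> 3 is used. *)

(** * Commutator calculus in the lower central series *)

Section LowerCentral.
Import mathcomp.boot.fintype mathcomp.boot.finset.
Local Open Scope group_scope.
Variable gT : finGroupType.
Implicit Types (E G H K N T : {group gT}) (x y z : gT).

Lemma three_subgroup_mod N G H K :
    G \subset 'N(N) -> H \subset 'N(N) -> K \subset 'N(N) ->
    [~: G, H, K] \subset N -> [~: H, K, G] \subset N ->
  [~: K, G, H] \subset N.
Proof.
move=> nG nH nK GHK HKG.
have nR (A B : {group gT}) : A \subset 'N(N) -> B \subset 'N(N) ->
    [~: A, B] \subset 'N(N).
  by move=> nA nB; apply: subset_trans (commg_sub _ _) _; rewrite join_subG nA.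
have triv (A B C : {group gT}) :
    A \subset 'N(N) -> B \subset 'N(N) -> C \subset 'N(N) ->
    ([~: A, B, C] \subset N) = ([~: A / N, B / N, C / N] == 1).
  move=> nA nB nC; rewrite -quotient_sub1 ?nR // !quotientR ?nR //.
  by apply/idP/eqP=> [/trivgP | ->].
rewrite triv //; apply/eqP; apply: three_subgroup; apply/eqP; rewrite -triv //.
Qed.

Lemma lcn_comm E i j : [~: 'L_i.+1(E), 'L_j.+1(E)] \subset 'L_(i + j).+2(E).
Proof.
elim: j i => [|j IH] i; first by rewrite addn0 -lcnSn.
rewrite [X in [~: _, X]]lcnSn commGC.
apply: three_subgroup_mod; rewrite ?lcn_norm ?(subset_trans (lcn_sub _ _)) ?lcn_norm //.
  by have := IH i.+1; rewrite addnS addSn [[~: E, _]]commGC.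
by rewrite addnS; apply: commSg; apply: IH.
Qed.

Lemma mem_lcn_comm E i j x y :
  x \in 'L_i.+1(E) -> y \in 'L_j.+1(E) -> [~ x, y] \in 'L_(i + j).+2(E).
Proof. by move=> Lx Ly; apply: subsetP (lcn_comm E i j) _ (mem_commg Lx Ly). Qed.

(** This is the Hall-Witt identity, once each inverse and each conjugation in
    it has been absorbed: they only change the entries by commutators whose weight
    is too large to matter. *)
Lemma lcn_jacobi_nil E i j k x y z : 'L_(i + j + k).+4(E) = 1 ->
    x \in 'L_i.+1(E) -> y \in 'L_j.+1(E) -> z \in 'L_k.+1(E) ->
  [~ x, y, z] * [~ y, z, x] * [~ z, x, y] = 1.
Proof.
move=> L1.
have L1P w : w \in 'L_(i + j + k).+4(E) -> w = 1 by rewrite L1 => /set1P.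
have cE w g : w \in 'L_(i + j + k).+3(E) -> g \in E -> commute w g.
  by move=> Lw Eg; apply/commgP/eqP/L1P; rewrite lcnSn mem_commg.
have LE m w : w \in 'L_m(E) -> w \in E by apply: subsetP (lcn_sub _ _) w.
have key a b c (u v w : gT) : (a + b + c = i + j + k)%N ->
    u \in 'L_a.+1(E) -> v \in 'L_b.+1(E) -> w \in 'L_c.+1(E) ->
  [~ u, v^-1, w] ^ v = [~ u, v, w]^-1.
  move=> abc Lu Lv Lw.
  have Luv := mem_lcn_comm Lu Lv.
  have Luvv : [~ [~ u, v]^-1, v^-1] \in 'L_(a + b).+3(E).
    rewrite lcnSn; apply: mem_commg; first by rewrite groupV.
    by rewrite groupV (LE _ _ Lv).
  have Luvw : [~ u, v, w] \in 'L_(i + j + k).+3(E).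
    by rewrite -abc; apply: (mem_lcn_comm (i := (a + b).+1)).
  have Luvw' : [~ [~ u, v]^-1, w] \in 'L_(i + j + k).+3(E).
    by rewrite -abc; apply: (mem_lcn_comm (i := (a + b).+1)); rewrite ?groupV.
  have Luvvw : [~ [~ [~ u, v]^-1, v^-1], w] = 1.
    apply: L1P; rewrite -abc.
    exact: (mem_lcn_comm (i := (a + b).+2)).
  have -> : [~ u, v^-1] = [~ u, v]^-1 * [~ [~ u, v]^-1, v^-1].
    by rewrite -conjg_mulR !commgEl !conjgE !invMg !invgK !mulgA mulgV mul1g.
  rewrite commMgJ Luvvw mulg1 !conjgE.
  rewrite (cE _ _ Luvw') ?(LE _ _ Luvv) // mulKg.
  rewrite (cE _ _ Luvw') ?(LE _ _ Lv) // mulKg.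
  by apply: commVg; apply/commute_sym/cE; rewrite // (LE _ _ Luv).
move=> Lx Ly Lz.
have := Hall_Witt_identity x y z.
have jki : (j + k + i = i + j + k)%N by rewrite addnC addnA.
have kij : (k + i + j = i + j + k)%N by rewrite -addnA addnC.
rewrite (key i j k) // (key j k i) // (key k i j) //.

have Lc a b c (u v w : gT) : (a + b + c = i + j + k)%N ->
    u \in 'L_a.+1(E) -> v \in 'L_b.+1(E) -> w \in 'L_c.+1(E) ->
  [~ u, v, w]^-1 \in 'L_(i + j + k).+3(E).
  move=> abc Lu Lv Lw; rewrite groupV -abc.
  by apply: (mem_lcn_comm (i := (a + b).+1)) => //; apply: mem_lcn_comm.
have L1' := Lc i j k x y z (erefl _) Lx Ly Lz.
have L2' : [~ y, z, x]^-1 \in 'L_(i + j + k).+3(E).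
  exact: (Lc j k i).
have L3' : [~ z, x, y]^-1 \in 'L_(i + j + k).+3(E).
  exact: (Lc k i j).
move=> HW; apply: invg_inj; rewrite invg1 -[RHS]HW [LHS]invMg [X in _ * X]invMg.
by rewrite (cE _ _ L3') ?(cE _ _ L2') ?groupM // ?(LE _ _ L1') ?(LE _ _ L2').
Qed.

End LowerCentral.

Section Jacobi.
Import mathcomp.boot.fintype mathcomp.boot.finset.
Local Open Scope group_scope.
Variable gT : finGroupType.
Implicit Types (E G H K N T : {group gT}) (x y z : gT).

Lemma lcn_jacobi E i j k x y z :
    x \in 'L_i.+1(E) -> y \in 'L_j.+1(E) -> z \in 'L_k.+1(E) ->
  [~ x, y, z] * [~ y, z, x] * [~ z, x, y] \in 'L_(i + j + k).+4(E).
Proof.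
move=> Lx Ly Lz.
have [N defN] : exists N : {group gT}, N :=: 'L_(i + j + k).+4(E).
  by exists 'L_(i + j + k).+4(E)%G.
have nN : E \subset 'N(N) by rewrite defN lcn_norm.
have L1 : 'L_(i + j + k).+4(E / N) = 1.
  by rewrite -morphim_lcn // -defN; apply: trivg_quotient.
rewrite -defN.
have LE m w : w \in 'L_m(E) -> w \in 'N(N).
  by move=> Lw; apply: subsetP nN _ (subsetP (lcn_sub _ _) _ Lw).
have Lq m w : w \in 'L_m(E) -> coset N w \in 'L_m(E / N).
  by move=> Lw; rewrite -morphim_lcn // mem_quotient.
have [[nx ny] nz] := (LE _ _ Lx, LE _ _ Ly, LE _ _ Lz).
have nc a b c : a \in 'N(N) -> b \in 'N(N) -> c \in 'N(N) -> [~ a, b, c] \in 'N(N).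
  by move=> na nb nc; rewrite groupR ?groupR.
have [[n1 n2] n3] := (nc _ _ _ nx ny nz, nc _ _ _ ny nz nx, nc _ _ _ nz nx ny).
have n12 := groupM n1 n2.
apply: coset_idr; first exact: groupM.
rewrite morphM // morphM //= !morphR ?groupR //.
by apply: (@lcn_jacobi_nil _ (E / N)%G i j k); try exact: Lq.
Qed.

(** The form in which the Jacobi identity is used: modulo a subgroup, two of its
    terms determine whether the third one vanishes. *)
Lemma jacobi_mem E T i j k x y z : 'L_(i + j + k).+4(E) \subset T ->
    x \in 'L_i.+1(E) -> y \in 'L_j.+1(E) -> z \in 'L_k.+1(E) ->
  [~ y, z, x] \in T -> [~ z, x, y] \in T -> [~ x, y, z] \in T.
Proof.
move=> sT Lx Ly Lz yzx zxy; have := subsetP sT _ (lcn_jacobi Lx Ly Lz).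
by rewrite (groupMr _ zxy) (groupMr _ yzx).
Qed.

End Jacobi.

(** * Counting a commutator subgroup one generator at a time *)

Lemma size_filter_notin (T : eqType) (xs s : seq T) : uniq xs ->
  size xs - size s <= size [seq x <- xs | x \notin s].
Proof.
move=> uxs; rewrite leq_subLR -(count_predC (fun x => x \in s)) -!size_filter.
rewrite leq_add2r; apply: uniq_leq_size; first exact: filter_uniq.
by move=> x; rewrite mem_filter => /andP[].
Qed.

Lemma perm_filter_in (T : eqType) (xs s : seq T) :
  perm_eq ([seq x <- xs | x \in s] ++ [seq x <- xs | x \notin s]) xs.
Proof. by rewrite perm_filterC. Qed.

Section Filtration.
Import mathcomp.boot.fintype mathcomp.boot.finset.
Local Open Scope group_scope.
Variable gT : finGroupType.
Implicit Types (E K N T Y : {group gT}) (x y z : gT).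

(** Adjoining to T the commutators [k, x], k in K. The map sending k to [k, x] is
    a morphism from K to the quotient by T, because [K, E, E] is contained in T; S is
    its kernel and T' the preimage of its image. *)
Lemma comm_extend_generator E K T x : K <| E -> [~: K, E, E] \subset T ->
    T \subset [~: K, E] -> x \in E ->
  exists T' S : {group gT},
    [/\ T \subset T' /\ T' \subset [~: K, E],
        {in K, forall k, [~ k, x] \in T'},
        S \subset K, {in K, forall k, [~ k, x] \in T -> k \in S}
      & #|T'| = (#|T| * #|K : S|)%N].
Proof.
case/andP=> sKE nKE sMT sTR Ex.
have nTE : E \subset 'N(T).
  by rewrite -commg_subl; apply: subset_trans (commSg _ sTR) sMT.
have kxE k : k \in K -> [~ k, x] \in E.
  by move=> Kk; rewrite groupR // (subsetP sKE).
have kxN k : k \in K -> [~ k, x] \in 'N(T) by move/kxE/(subsetP nTE).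
have fM : {in K &, {morph (fun k => coset T [~ k, x]) : k l / k * l}}.
  move=> k l Kk Kl /=; rewrite commMgR.
  have kxlT : [~ k, x, l] \in T.
    by apply: (subsetP sMT); rewrite mem_commg ?mem_commg // (subsetP sKE).
  have nkxl := subsetP (normG T) _ kxlT.
  rewrite morphM ?(groupM (kxN _ Kk) nkxl) ?kxN // morphM ?kxN //=.
  by rewrite (coset_id kxlT) mulg1.
pose f := Morphism fM.
have sfR : f @* K \subset [~: K, E] / T.
  apply/subsetP=> _ /morphimP[k _ Kk ->] /=.
  by rewrite mem_quotient // mem_commg.
have sRN : [~: K, E] \subset 'N(T).
  apply: subset_trans nTE; apply: subset_trans (commg_sub _ _) _.
  by rewrite join_subG sKE subxx.
exists (coset T @*^-1 (f @* K))%G, ('ker f)%G; split.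
- split; first exact: sub_cosetpre.
  have nTR : T <| [~: K, E] by rewrite /normal sTR.
  by have := quotientGK nTR; rewrite /= => <-; rewrite cosetpreSK.
- by move=> k Kk; rewrite mem_morphpre ?kxN //= (mem_morphim f).
- exact: subsetIl.
- by move=> k Kk kxT; apply/kerP => //=; apply: coset_id.
- by rewrite card_cosetpre card_morphim setIid.
Qed.

(** If N is central modulo [K, E, E], each generator multiplies the order by at most
    |K : N|. When g holds, every generator has a k outside N with [k, x] already
    known, so that the kernel is strictly larger than N and a factor p is saved. *)
Lemma comm_filter p (g : bool) E K N T (xs : seq gT) :
    prime p -> p.-group K -> K <| E -> N \subset K ->
    [~: N, E] \subset [~: K, E, E] -> {subset xs <= E} ->
    [~: K, E, E] \subset T -> T \subset [~: K, E] ->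
    (g -> {in xs, forall x, exists2 k, k \in K :\: N & [~ k, x] \in T}) ->
  exists T' : {group gT},
    [/\ T \subset T', T' \subset [~: K, E],
        {in K & xs, forall k x, [~ k, x] \in T'}
      & #|T'| * p ^ (g * size xs) <= #|T| * #|K : N| ^ size xs]%N.
Proof.
move=> p_pr pK nKE sNK sNE; elim: xs T => [|x xs IH] T sxE sMT sTR gain.
  by exists T; split; rewrite ?muln0.
have Ex : x \in E by rewrite sxE ?mem_head.
have [T1 [S [[sTT1 sT1R] KxT1 sSK SP oT1]]] := comm_extend_generator nKE sMT sTR Ex.
have sNS : N \subset S.
  apply/subsetP=> n Nn; apply: SP; first exact: (subsetP sNK).
  by apply: (subsetP sMT); apply: (subsetP sNE); apply: mem_commg.
have leT1 : (#|T1| * p ^ g <= #|T| * #|K : N|)%N.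
  rewrite oT1 -(Lagrange_index sSK sNS) mulnA leq_mul2l.
  case: g gain {IH} => [gain|_]; last by rewrite expn0 indexg_gt0 orbT.
  have [//|k /setDP[Kk nNk] kxT] := gain isT x; first exact: mem_head.
  have: #|S : N| != 1%N.
    apply: contra nNk; rewrite indexg_eq1 => /subsetP; apply; exact: SP.
  have: p.-nat #|S : N|.
    exact: pnat_dvd (dvdn_indexg _ _) (pgroupS sSK pK).
  case/p_natP=> [[|m]] -> // _.
  by rewrite leq_exp2l ?prime_gt1 ?orbT.
have [||||T' [sT1T' sT'R xsT' leT']] := IH T1.
- by move=> y yxs; rewrite sxE // inE yxs orbT.
- exact: subset_trans sMT sTT1.
- exact: sT1R.
- move=> /gain{}gain y yxs; have [|k Kk kyT] := gain y; first by rewrite inE yxs orbT.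
  by exists k => //; apply: (subsetP sTT1).
exists T'; split=> //; first exact: subset_trans sT1T'.
  move=> k y Kk; rewrite inE => /predU1P[->|/xsT'->//].
  by apply: (subsetP sT1T'); apply: KxT1.
rewrite /= mulnS expnD mulnCA expnS.
apply: leq_trans (leq_mul (leqnn _) leT') _.
by rewrite !mulnA leq_mul2r [(p ^ g * _)%N]mulnC leT1 orbT.
Qed.

Lemma comm_generated E T Y (K : {set gT}) (xs : seq gT) :
    E \subset 'N(T) -> K \subset E -> Y \subset E -> {subset xs <= E} ->
    E \subset <<[set x in xs]>> <*> Y -> [~: K, Y] \subset T ->
    {in K & xs, forall k x, [~ k, x] \in T} ->
  [~: K, E] \subset T.
Proof.
move=> nTE sKE sYE sxE genE sKYT KxT; have nTK := subset_trans sKE nTE.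
have cP (A : {set gT}) : A \subset 'N(T) ->
    ([~: K, A] \subset T) = (A \subset coset T @*^-1 'C(K / T)).
  move=> nTA; rewrite -quotient_cents2 // centsC.
  by rewrite -sub_quotient_pre.
rewrite cP //; apply: subset_trans genE _; rewrite join_subG.
rewrite -[X in _ && X]cP ?(subset_trans sYE) // sKYT andbT gen_subG.
apply/subsetP=> x; rewrite inE => xsx.
have nTx : x \in 'N(T) by rewrite (subsetP nTE) ?sxE.
apply: subsetP (set11 x); rewrite -cP ?sub1set // gen_subG.
apply/subsetP=> _ /imset2P[k y Kk /set1P-> ->]; exact: KxT.
Qed.

(** The generators zs are adjoined first, at full cost; those in ys come last, and
    each of them saves a factor p. *)
Lemma card_commg_gain p E K N Y (zs ys : seq gT) :
    prime p -> p.-group K -> K <| E -> N \subset K ->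
    [~: N, E] \subset [~: K, E, E] -> Y \subset E -> [~: K, Y] \subset [~: K, E, E] ->
    {subset zs ++ ys <= E} -> E \subset <<[set x in zs ++ ys]>> <*> Y ->
  (forall T, [~: K, E, E] \subset T -> {in K & zs, forall k x, [~ k, x] \in T} ->
    {in ys, forall x, exists2 k, k \in K :\: N & [~ k, x] \in T}) ->
  (#|[~: K, E]| * p ^ size ys <= #|[~: K, E, E]| * #|K : N| ^ (size zs + size ys))%N.
Proof.
move=> p_pr pK nKE sNK sNE sYE sKY sxE genE gain.
have [sKE nEK] := andP nKE.
have sRR : [~: K, E, E] \subset [~: K, E].
  by rewrite commg_subl commg_normr.
have zsE : {subset zs <= E} by move=> x xzs; apply: (sxE x); rewrite mem_cat xzs.
have ysE : {subset ys <= E} by move=> x xys; apply: (sxE x); rewrite mem_cat xys orbT.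
have [//|T1 [sT1 sT1R KxT1 leT1]] :=
  @comm_filter p false E K N _ zs p_pr pK nKE sNK sNE zsE (subxx _) sRR.
have gain1 := gain T1 sT1 KxT1.
have [//|T2 [sT12 sT2R KxT2 leT2]] :=
  @comm_filter p true E K N T1 ys p_pr pK nKE sNK sNE ysE sT1 sT1R.
have sT2 := subset_trans sT1 sT12.
have nT2E : E \subset 'N(T2).
  by rewrite -commg_subl; apply: subset_trans (commSg _ sT2R) sT2.
have sRT2 : [~: K, E] \subset T2.
  apply: comm_generated genE _ _ => //; first exact: subset_trans sKY sT2.
  move=> k x Kk; rewrite mem_cat => /orP[xzs|]; last exact: KxT2.
  by apply: (subsetP sT12); apply: KxT1.
apply: leq_trans (_ : #|T2| * p ^ size ys <= _)%N.
  by rewrite leq_mul2r subset_leq_card ?orbT.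
rewrite mul1n in leT2; apply: leq_trans leT2 _; rewrite expnD mulnA leq_mul2r.
by move: leT1; rewrite mul0n muln1 => ->; rewrite orbT.
Qed.

Lemma commVgJ (c x : gT) : [~ c^-1, x] = [~ c, x]^-1 ^ c^-1.
Proof.
rewrite [_ ^ _]conjgE ![[~ _, x]]commgEl !conjgE.
by rewrite !invMg !invgK !mulgA mulgK.
Qed.

(** Commutation with the generators is tested in each variable in turn. *)
Lemma der1_generated E T Y (xs : seq gT) : T <| E -> Y \subset E -> {subset xs <= E} ->
    E \subset <<[set x in xs]>> <*> Y -> [~: E, Y] \subset T ->
    {in xs &, forall x y, [~ x, y] \in T} ->
  E^`(1) \subset T.
Proof.
case/andP=> sTE nTE sYE sxE genE sEYT xyT.
apply: (comm_generated nTE (subxx _) sYE sxE genE sEYT) => e x Ee xsx.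
have Ex := sxE x xsx.
have: [~: [set x], E] \subset T.
  apply: (comm_generated nTE _ sYE sxE genE); first by rewrite sub1set.
    by apply: subset_trans (commSg _ _) sEYT; rewrite sub1set.
  by move=> _ y /set1P-> ysy; apply: xyT.
rewrite commGC => /subsetP; apply; apply: mem_commg => //; exact: set11.
Qed.

Lemma nil_class_lcn_sub E i :
  nilpotent E -> 'L_i.+1(E) \subset 'L_i.+2(E) -> nil_class E <= i.
Proof.
move=> nilE sL; apply/(lcn_nil_classP _ nilE).
move/forall_inP: nilE => /(_ 'L_i.+1(E)%G) h.
by apply/eqP/h; rewrite subsetI lcn_sub.
Qed.

End Filtration.

(** * The lower central factors of a central extension *)

Section CentralExtension.
Import mathcomp.boot.fintype mathcomp.boot.finset.
Local Open Scope group_scope.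
Variables (gT rT : finGroupType) (E : {group gT}) (pi : {morphism E >-> rT}).
Hypothesis central_ker : 'ker pi \subset 'Z(E).
Local Notation G := (pi @* E)%G.
Local Notation Y := (pi @*^-1 'Z(pi @* E))%G.
Implicit Types (T : {group gT}) (x y z : gT).

(** [Y, E] lies in the kernel of pi, which is central, so [Y, E, E] = 1 and the
    three subgroups lemma applies. *)
Lemma commg_der1_preim_center : [~: E^`(1), Y] = 1.
Proof.
have sYE : Y \subset E by exact: subsetIl.
have YE : [~: Y, E] \subset 'ker pi.
  rewrite gen_subG; apply/subsetP=> _ /imset2P[y e /morphpreP[Ey Zy] Ee ->].
  apply/kerP; first exact: groupR.
  rewrite morphR //; apply/eqP/commgP.
  by case/centerP: Zy => _; apply; apply: mem_morphim.
have YEE : [~: Y, E, E] = 1.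
  apply/trivgP; apply: subset_trans (commSg _ YE) _.
  rewrite -[[~: _, E]]/[~: 'ker pi, E] subG1; apply/eqP/commG1P.
  exact: subset_trans central_ker (subsetIr _ _).
apply: three_subgroup => //.
by rewrite [[~: E, Y]]commGC.
Qed.

Lemma commg_preim_center : [~: E, Y] \subset 'ker pi.
Proof.
rewrite gen_subG; apply/subsetP=> _ /imset2P[e y Ee /morphpreP[Ey Zy] ->].
apply/kerP; first exact: groupR.
rewrite morphR //; apply/eqP/commgP/commute_sym.
by case/centerP: Zy => _; apply; apply: mem_morphim.
Qed.

(** An element of the subgroup on the left differs from an element of L_(i+2)(E) by
    a central one. This makes it the right N for bounding [L_(i+1)(E), E]. *)
Lemma lcn_preim_comm i : [~: 'L_i.+1(E) :&: pi @*^-1 'L_i.+2(G), E] \subset 'L_i.+3(E).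
Proof.
rewrite gen_subG; apply/subsetP=> _ /imset2P[k e /setIP[_ /morphpreP[Ek Lk]] Ee ->].
move: Lk; rewrite -morphim_lcn // => /morphimP[l El Ll eqkl].
have [a Ka ->] := ker_rcoset Ek El eqkl.
have [Ea cEa] := setIP (subsetP central_ker _ Ka).
rewrite commMgJ.
have -> : [~ a, e] = 1 by apply/eqP/commgP; apply: (centP cEa).
by rewrite conj1g mul1g; apply: (mem_commg (A := 'L_i.+2(E))).
Qed.

Lemma lcn_preim_index i :
  #|'L_i.+1(E) : 'L_i.+1(E) :&: pi @*^-1 'L_i.+2(G)| = #|'L_i.+1(G) : 'L_i.+2(G)|.
Proof.
have := @index_morphim_ker _ _ _ pi 'L_i.+1(E)%G
  ('L_i.+1(E) :&: pi @*^-1 'L_i.+2(G))%G (subsetIl _ _) (lcn_sub _ _).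
rewrite (_ : #|'ker_'L_i.+1(E) pi : _| = 1)%N ?muln1 => [<-|].
  rewrite /= morphim_setIpre !morphim_lcn //=.
  by have /setIidPr-> := lcn_subS i.+1 G.
by apply/eqP; rewrite indexg_eq1 /= setIS ?ker_sub_pre.
Qed.

Lemma lift_generating_seq (H : {group rT}) (bs : seq (coset_of H)) :
    H <| G -> <<[set b in bs]>> = G / H ->
  exists xs : seq gT,
    [/\ [seq coset H (pi x) | x <- xs] = bs, {subset xs <= E}
      & E \subset <<[set x in xs]>> <*> pi @*^-1 H].
Proof.
case/andP=> sHG nHG genbs.
have bsG : {subset bs <= G / H} by move=> b bsb; rewrite -genbs mem_gen ?inE.
have [xs xsE xsbs] : exists2 xs : seq gT, {subset xs <= E}
    & [seq coset H (pi x) | x <- xs] = bs.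
  elim: bs bsG {genbs} => [|b bs IH] bsG; first by exists [::].
  have [|xs xsE <-] := IH; first by move=> c cbs; rewrite bsG // inE cbs orbT.
  have /morphimP[g _ Gg ->] := bsG b (mem_head _ _).
  have /morphimP[x Ex _ ->] := Gg.
  by exists (x :: xs) => // y; rewrite inE => /predU1P[-> //|/xsE].
exists xs; split=> //.
have sKY : 'ker pi \subset <<[set x in xs]>> <*> pi @*^-1 H.
  by apply: subset_trans (joing_subr _ _); apply: ker_sub_pre.
rewrite -(morphimSGK _ sKY) //.
have sHxs : H \subset pi @* (<<[set x in xs]>> <*> pi @*^-1 H).
  apply: subset_trans (morphimS _ (joing_subr _ _)).
  by rewrite morphpreK.
rewrite -(quotientSGK nHG sHxs) -genbs gen_subG.
apply/subsetP=> b; rewrite inE -xsbs => /mapP[x xsx ->].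
apply: mem_quotient; apply: mem_morphim; first exact: xsE.
by rewrite mem_gen // inE mem_gen // inE.
Qed.

Lemma lift_min_generators : exists xs : seq gT,
  [/\ uniq xs, size xs = 'm(G / 'Z(G)), {subset xs <= E}
    & E \subset <<[set x in xs]>> <*> Y].
Proof.
have [B genB oB] := grank_witness (G / 'Z(G))%G.
have genB' : <<[set b in enum B]>> = G / 'Z(G).
  by rewrite -[RHS]genB; congr <<_>>; apply/setP=> b; rewrite inE mem_enum.
have [xs [xsB xsE genE]] := lift_generating_seq (center_normal G) genB'.
exists xs; split=> //.
- by apply: (@map_uniq _ _ (fun x => coset 'Z(G) (pi x))); rewrite xsB enum_uniq.
- by rewrite -(size_map (fun x => coset 'Z(G) (pi x))) xsB -cardE.
Qed.

Section Generators.
Variables (p : nat) (xs : seq gT).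
Hypotheses (p_pr : prime p) (pE : p.-group E).
Hypotheses (sxE : {subset xs <= E}) (genE : E \subset <<[set x in xs]>> <*> Y).

(** The counting lemma for K = L_(i+2)(E): the subgroup N consists of the k whose
    image lies in L_(i+3)(G), so that |K : N| is an index in G. *)
Lemma card_lcn_gain i (zs ys : seq gT) : perm_eq (zs ++ ys) xs ->
    (forall T, 'L_i.+4(E) \subset T ->
       {in 'L_i.+2(E) & zs, forall k x, [~ k, x] \in T} ->
     {in ys, forall x, exists k,
       [/\ k \in 'L_i.+2(E), pi k \notin 'L_i.+3(G) & [~ k, x] \in T]}) ->
  (#|'L_i.+3(E)| * p ^ size ys <=
   #|'L_i.+4(E)| * #|'L_i.+2(G) : 'L_i.+3(G)| ^ size xs)%N.
Proof.
move=> zy gain; rewrite -lcn_preim_index -(perm_size zy) size_cat.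
have sLE : 'L_i.+2(E) \subset E^`(1) by rewrite -lcn2 lcn_sub_leq.
apply: (@card_commg_gain _ p E 'L_i.+2(E)%G _ Y) => //.
- exact: pgroupS (lcn_sub _ _) pE.
- exact: lcn_normal.
- exact: subsetIl.
- exact: lcn_preim_comm.
- exact: subsetIl.
- by apply: subset_trans (commSg _ sLE) _; rewrite commg_der1_preim_center sub1G.
- by move=> x; rewrite (perm_mem zy); apply: sxE.
- suff -> : [set x in zs ++ ys] = [set x in xs] by [].
  by apply/setP=> x; rewrite !inE (perm_mem zy).
move=> T sT kzT x xys; have [k [Lk nLk kxT]] := gain T sT kzT x xys.
exists k => //; rewrite inE Lk andbT inE Lk /=.
by apply: contra nLk => /morphpreP[].
Qed.

Lemma card_lcn_bound i : (#|'L_i.+3(E)| <=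
   #|'L_i.+4(E)| * #|'L_i.+2(G) : 'L_i.+3(G)| ^ size xs)%N.
Proof.
have := @card_lcn_gain i xs [::]; rewrite cats0 muln1; apply=> //.
Qed.

Lemma lcn_preim_normal i : pi @*^-1 'L_i(G) <| E.
Proof.
suff : pi @*^-1 'L_i(G) <| pi @*^-1 (pi @* E) by rewrite morphimGK // subsetIl.
by rewrite morphpre_normal ?lcn_normal ?lcn_sub.
Qed.

(** Otherwise the generators commute modulo the preimage of L_3(G), hence so does
    E, and the lower central series of G stops too early. *)
Lemma ex_generators_comm2 : nilpotent G -> 2 < nil_class G ->
  exists x y, [/\ x \in xs, y \in xs & pi [~ x, y] \notin 'L_3(G)].
Proof.
move=> nilG cG.
case: (boolP (has (fun x => has (fun y => pi [~ x, y] \notin 'L_3(G)) xs) xs)).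
  by case/hasP=> x xsx /hasP[y xsy xy]; exists x, y.
move=> /hasPn h; suff /(nil_class_lcn_sub nilG) : 'L_2(G) \subset 'L_3(G).
  by rewrite leqNgt (ltnW cG).
rewrite -morphim_lcn // lcn2 sub_morphim_pre ?der_sub //.
apply: (der1_generated (T := (pi @*^-1 'L_3(G))%G) _ _ sxE genE).
- exact: lcn_preim_normal.
- exact: subsetIl.
- by apply: subset_trans commg_preim_center _; apply: ker_sub_pre.
move=> x y xsx xsy; have /hasPn/(_ y xsy) := h x xsx.
rewrite negbK => xyL; apply/morphpreP; split=> //.
by rewrite groupR ?sxE.
Qed.

(** Otherwise all [x, y] for generators x, y are central modulo the preimage P of
    L_4(G); then so is E', that is, L_3(G) is contained in L_4(G). *)
Lemma ex_generators_comm3 : nilpotent G -> 2 < nil_class G ->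
  exists x y z, [/\ x \in xs, y \in xs, z \in xs & pi [~ x, y, z] \notin 'L_4(G)].
Proof.
move=> nilG cG.
case: (boolP (has (fun x => has (fun y => has (fun z =>
  pi [~ x, y, z] \notin 'L_4(G)) xs) xs) xs)).
  by case/hasP=> x xsx /hasP[y xsy /hasP[z xsz xyz]]; exists x, y, z.
move=> /hasPn h; suff /(nil_class_lcn_sub nilG) : 'L_3(G) \subset 'L_4(G).
  by rewrite leqNgt cG.
pose P := (pi @*^-1 'L_4(G))%G.
have nPE : P <| E := lcn_preim_normal 4; have nPE' := normal_norm nPE.
have sYE : Y \subset E by exact: subsetIl.
have EYP : [~: E, Y] \subset P.
  by apply: subset_trans commg_preim_center _; apply: ker_sub_pre.
pose T := (coset P @*^-1 'Z(E / P))%G.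
have nTE : T <| E.
  have : T <| coset P @*^-1 (E / P) by rewrite cosetpre_normal center_normal.
  by rewrite quotientGK.
have TP (A : {set gT}) : A \subset E -> [~: A, E] \subset P -> A \subset T.
  move=> sAE AEP; have nPA := subset_trans sAE nPE'.
  rewrite /= -sub_quotient_pre // subsetI quotientS //=.
  by rewrite quotient_cents2.
rewrite -!morphim_lcn // sub_morphim_pre ?lcn_sub // morphim_lcn //.
apply: subset_trans (_ : [~: T, E] \subset _); last first.
  rewrite -quotient_cents2 //; last exact: subset_trans (normal_sub nTE) nPE'.
  by rewrite cosetpreK subsetIr.
apply: commSg; apply: (der1_generated nTE sYE sxE genE).
  apply: TP; first by rewrite commg_subl (subset_trans sYE) ?normG.
  by rewrite -[P : {set _}]/(gval P) (subset_trans (commSg _ EYP)) // commg_subl.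
move=> x y xsx xsy; rewrite -sub1set; apply: TP; rewrite ?sub1set ?groupR ?sxE //.
apply: (comm_generated nPE' _ sYE sxE genE); rewrite ?sub1set ?groupR ?sxE //.
  by apply: subset_trans (commSg _ _) EYP; rewrite sub1set groupR ?sxE.
move=> _ z /set1P-> xsz; apply/morphpreP; split; first by rewrite !groupR ?sxE.
by have /hasPn/(_ y xsy)/hasPn/(_ z xsz) := h x xsx; rewrite negbK.
Qed.

Hypotheses (uxs : uniq xs) (nilG : nilpotent G) (cG : 2 < nil_class G).

(** Take k = [x1, x2] nontrivial and put x1, x2 first. By the Jacobi identity
    [x1, x2, y] is a product of commutators of the form [l, x1] and [l, x2]. *)
Lemma card_lcn3_gain : (#|'L_3(E)| * p ^ (size xs - 2) <=
  #|'L_4(E)| * #|'L_2(G) : 'L_3(G)| ^ size xs)%N.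
Proof.
have [x1 [x2 [xs1 xs2 nx12]]] := ex_generators_comm2 nilG cG.
apply: leq_trans (@card_lcn_gain 0 _ _ (perm_filter_in xs [:: x1; x2]) _).
  by rewrite leq_mul2l leq_exp2l ?prime_gt1 // (size_filter_notin [:: x1; x2] uxs) orbT.
move=> T sT kzT y; rewrite mem_filter => /andP[_ xsy].
have L1 : {in xs, forall x, x \in 'L_1(E)} by [].
have zT x k : x \in xs -> x \in [:: x1; x2] -> k \in 'L_2(E) -> [~ k, x] \in T.
  by move=> xsx xx Lk; apply: kzT => //; rewrite mem_filter xx.
exists [~ x1, x2]; split=> //; first by rewrite mem_commg ?sxE.
apply: (jacobi_mem (E := E) (i := 0) (j := 0) (k := 0)); rewrite ?L1 //;
  apply: zT;  by rewrite ?inE ?eqxx ?orbT ?mem_commg ?sxE.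
Qed.

(** Take k = [x1, x2, x3] nontrivial and put x1, x2, x3 first. Let u = [x1, x2].
    The Jacobi identity for u, x3, y reduces [u, x3, y] to commutators with x3 and to
    [[x3, y], u]; a second one, for x1, x2 and [x3, y], reduces the latter to
    commutators with x1 and x2. *)
Lemma card_lcn4_gain : (#|'L_4(E)| * p ^ (size xs - 3) <=
  #|'L_5(E)| * #|'L_3(G) : 'L_4(G)| ^ size xs)%N.
Proof.
have [x1 [x2 [x3 [xs1 xs2 xs3 nx123]]]] := ex_generators_comm3 nilG cG.
apply: leq_trans (@card_lcn_gain 1 _ _ (perm_filter_in xs [:: x1; x2; x3]) _).
  rewrite leq_mul2l leq_exp2l ?prime_gt1 //.
  by rewrite (size_filter_notin [:: x1; x2; x3] uxs) orbT.
move=> T sT kzT y; rewrite mem_filter => /andP[_ xsy].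
have L1 : {in xs, forall x, x \in 'L_1(E)} by [].
have zT x k : x \in xs -> x \in [:: x1; x2; x3] -> k \in 'L_3(E) -> [~ k, x] \in T.
  by move=> xsx xx Lk; apply: kzT => //; rewrite mem_filter xx.
have Lu : [~ x1, x2] \in 'L_2(E) by rewrite mem_commg ?sxE.
have Lv : [~ x3, y] \in 'L_2(E) by rewrite mem_commg ?sxE.
have L3l x k : x \in xs -> k \in 'L_2(E) -> [~ k, x] \in 'L_3(E).
  by move=> xsx Lk; apply: mem_commg Lk (sxE xsx).
have L3r x k : x \in xs -> k \in 'L_2(E) -> [~ x, k] \in 'L_3(E).
  by move=> xsx Lk; rewrite -invg_comm groupV L3l.
exists [~ x1, x2, x3]; split=> //; first exact: L3l.
apply: (jacobi_mem (E := E) (i := 1) (j := 0) (k := 0)); rewrite ?L1 //; last first.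
  by apply: zT; rewrite ?inE ?eqxx ?orbT ?L3r.
rewrite -invg_comm groupV.
apply: (jacobi_mem (E := E) (i := 0) (j := 0) (k := 1)); rewrite ?L1 //;
  apply: zT; rewrite ?inE ?eqxx ?orbT //.
  exact: L3r.
exact: L3l.
Qed.

Lemma card_lcn4_gain_at y k : y \in xs -> k \in 'L_3(E) -> pi k \notin 'L_4(G) ->
    (forall T, 'L_5(E) \subset T ->
      {in 'L_3(E) & rem y xs, forall l x, [~ l, x] \in T} -> [~ k, y] \in T) ->
  (#|'L_4(E)| * p <= #|'L_5(E)| * #|'L_3(G) : 'L_4(G)| ^ size xs)%N.
Proof.
move=> xsy Lk nLk kyT.
have := @card_lcn_gain 1 (rem y xs) [:: y]; rewrite expn1; apply.
  by rewrite perm_sym (permPl (perm_to_rem xsy)) -cat1s perm_catC.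
move=> T sT remT x; rewrite inE => /eqP->.
by exists k; split=> //; apply: kyT.
Qed.

(** Two sources of relations. If [x, y, x] is nontrivial, the Jacobi identity for
    [x, y], x, y gives [x, y, x, y] = [x, y, y, x], and the generator y is saved once
    x is known. If all [x, y, x] are trivial, expanding [[x1, x2], [x3, x1]] in both
    ways gives [[x1, x2, x3] - [x3, x1, x2], x1] = 0 in additive notation, and x1 is
    saved unless [x1, x2, x3] is invariant under rotation; that cannot hold for all
    rotations of a nontrivial commutator, since 3 is invertible modulo p. *)
Lemma card_lcn4_gain1 : p != 3 -> (#|'L_4(E)| * p <=
  #|'L_5(E)| * #|'L_3(G) : 'L_4(G)| ^ size xs)%N.
Proof.
move=> p3.
have L1 : {in xs, forall x, x \in 'L_1(E)} by [].
have L2 : {in xs &, forall x y, [~ x, y] \in 'L_2(E)}.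
  by move=> x y xsx xsy; rewrite mem_commg ?sxE.
have L3l x k : x \in xs -> k \in 'L_2(E) -> [~ k, x] \in 'L_3(E).
  by move=> xsx Lk; apply: mem_commg Lk (sxE xsx).
have L3r x k : x \in xs -> k \in 'L_2(E) -> [~ x, k] \in 'L_3(E).
  by move=> xsx Lk; rewrite -invg_comm groupV L3l.
case: (boolP (has (fun x => has (fun y => pi [~ x, y, x] \notin 'L_4(G)) xs) xs)).
  case/hasP=> x xsx /hasP[y xsy nxyx].
  have Nxy : x != y.
    by apply: contraNneq nxyx => <-; rewrite commgg comm1g morph1.
  apply: (card_lcn4_gain_at xsy _ nxyx); first by rewrite L3l ?L2.
  move=> T sT remT.
  apply: (jacobi_mem (E := E) (i := 1) (j := 0) (k := 0)); rewrite ?L1 ?L2 //.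
    by rewrite commgg.
  by apply: remT; rewrite ?L3r ?L2 // mem_rem_uniq // inE Nxy.
move=> /hasPn alt0.
have alt x y : x \in xs -> y \in xs -> pi [~ x, y, x] \in 'L_4(G).
  by move=> xsx xsy; have /hasPn/(_ y xsy) := alt0 x xsx; rewrite negbK.
have L5 k e : k \in 'L_3(E) -> pi k \in 'L_4(G) -> e \in E -> [~ k, e] \in 'L_5(E).
  move=> Lk pk Ee; apply: (subsetP (lcn_preim_comm 2)); apply: mem_commg => //.
  by rewrite inE Lk; apply/morphpreP; rewrite pk (subsetP (lcn_sub 3 E)).
(* The case where the double commutator relation saves x1. *)
have rot x1 x2 x3 : x1 \in xs -> x2 \in xs -> x3 \in xs ->
    pi ([~ x1, x2, x3] * [~ x3, x1, x2]^-1) \notin 'L_4(G) ->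
  (#|'L_4(E)| * p <= #|'L_5(E)| * #|'L_3(G) : 'L_4(G)| ^ size xs)%N.
  move=> xs1 xs2 xs3; set a := [~ x1, x2, x3]; set b := [~ x3, x1, x2] => nab.
  have La : a \in 'L_3(E) by rewrite L3l ?L2.
  have Lb : b \in 'L_3(E) by rewrite L3l ?L2.
  apply: (card_lcn4_gain_at xs1 _ nab); first by rewrite groupM ?groupV.
  move=> T sT _; apply: (subsetP sT) => {T sT}.
  set u := [~ x1, x2]; set v := [~ x3, x1].
  have [Lu Lv] : u \in 'L_2(E) /\ v \in 'L_2(E) by split; apply: L2.
  have Ex := sxE xs1.
  (* Expansion of [v, u] = - [u, v] along v, then along u; the terms that
     are dropped contain some [x, y, x]. *)
  have jac_u : [~ a, x1] * [~ v, u] \in 'L_5(E).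
    have := @lcn_jacobi _ E 1 0 0 u x3 x1 Lu (L1 _ xs3) (L1 _ xs1).
    rewrite groupMr //; apply: L5; [exact: L3r | | exact: sxE].
    by rewrite -invgR morphV ?groupV ?alt // groupR ?groupR ?sxE.
  have jac_v : [~ u, v] * [~ b^-1, x1] \in 'L_5(E).
    have := @lcn_jacobi _ E 0 0 1 x1 x2 v (L1 _ xs1) (L1 _ xs2) Lv.
    have -> : [~ x2, v] = b^-1 by rewrite invgR.
    rewrite groupMr //; apply: L5; [exact: L3l | | exact: sxE].
    have Ec : [~ x1, x3] \in E by rewrite groupR ?sxE.
    have -> : [~ v, x1] = [~ x1, x3, x1]^-1 ^ [~ x3, x1].
      by rewrite /v -(invgR x1 x3) commVgJ.
    rewrite morphJ ?morphV ?groupV ?groupR ?sxE //.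
    rewrite memJ_norm ?groupV ?alt // (subsetP (lcn_norm 4 G)) //.
    by rewrite mem_morphim ?groupR ?sxE.
  have := groupM jac_u jac_v.
  rewrite -(invgR v u) mulgA mulgK => ab; rewrite (commMgR a b^-1 x1).
  have La4 : [~ a, x1] \in 'L_4(E) by apply: mem_commg.
  have Eb : b \in E by apply: subsetP (lcn_sub _ _) _ Lb.
  have c5 : [~ a, x1, b^-1] \in 'L_5(E) by rewrite mem_commg ?groupV.
  have mulC (g h l : gT) : g * h * l = g * l * h ^ l by rewrite -!mulgA -conjgC.
  rewrite (mulC [~ a, x1]); apply: groupM => //.
  have Ed : [~ b^-1, x1] \in E by rewrite groupR ?groupV.
  by rewrite memJ_norm // (subsetP (lcn_norm 5 E)).
have [x1 [x2 [x3 [xs1 xs2 xs3 nx123]]]] := ex_generators_comm3 nilG cG.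
(* With a = b = c modulo L_4(G) for the three rotations a, b, c of the
   commutator, the Jacobi identity reads a ^+ 3 = 1. *)
have [ab|/(rot _ _ _ xs1 xs2 xs3)//] :=
  boolP (pi ([~ x1, x2, x3] * [~ x3, x1, x2]^-1) \in 'L_4(G)).
have [ca|/(rot _ _ _ xs2 xs3 xs1)//] :=
  boolP (pi ([~ x2, x3, x1] * [~ x1, x2, x3]^-1) \in 'L_4(G)).
case/negP: nx123.
have Eabc x y z : x \in xs -> y \in xs -> z \in xs -> [~ x, y, z] \in E.
  by move=> xsx xsy xsz; rewrite !groupR ?sxE.
have Ea := Eabc _ _ _ xs1 xs2 xs3; have Eb := Eabc _ _ _ xs3 xs1 xs2.
have Ec := Eabc _ _ _ xs2 xs3 xs1.
have jac : pi ([~ x1, x2, x3] * [~ x2, x3, x1] * [~ x3, x1, x2]) \in 'L_4(G).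
  rewrite -morphim_lcn // mem_morphim //.
    exact: groupM (groupM Ea Ec) Eb.
  exact: (lcn_jacobi (i := 0) (j := 0) (k := 0)) (L1 _ xs1) (L1 _ xs2) (L1 _ xs3).
have Eac := groupM Ea Ec.
have piMV g h : g \in E -> h \in E -> pi (g * h^-1) = pi g * (pi h)^-1.
  by move=> Eg Eh; rewrite morphM ?groupV // morphV.
move: ab ca jac; rewrite !piMV // (morphM _ Eac Eb) (morphM _ Ea Ec).
have nL : G \subset 'N('L_4(G)) := lcn_norm _ _.
have nLa := subsetP nL _ (mem_morphim pi Ea Ea).
have nLb := subsetP nL _ (mem_morphim pi Eb Eb).
have nLc := subsetP nL _ (mem_morphim pi Ec Ec).
have pa : p.-elt (pi [~ x1, x2, x3]) by apply/morph_p_elt/(mem_p_elt pE).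
move: (pi [~ x1, x2, x3]) (pi [~ x3, x1, x2]) (pi [~ x2, x3, x1]) nLa nLb nLc pa => a b c.
move=> nLa nLb nLc pa ab ca abc; apply: coset_idr => //.
have qab : coset 'L_4(G) b = coset 'L_4(G) a.
  apply/eqP; rewrite eq_sym eq_mulgV1 -morphV // -morphM ?groupV //=.
  by rewrite coset_id.
have qca : coset 'L_4(G) c = coset 'L_4(G) a.
  by apply/eqP; rewrite eq_mulgV1 -morphV // -morphM ?groupV //= coset_id.
have /eqP: coset 'L_4(G) a ^+ 3 = 1.
  rewrite 2!expgS expg1 mulgA -{2}qca -{2}qab.
  by rewrite -!morphM ?groupM //= coset_id.
rewrite -order_dvdn => a3; apply/eqP; rewrite -order_eq1.
have pqa : p.-elt (coset 'L_4(G) a) by apply: (morph_p_elt (coset_morphism _)).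
case/p_natP: pqa a3 => [[|m] ->] //.
move/(dvdn_trans (dvdn_exp (ltn0Sn m) (dvdnn p))).
by rewrite (dvdn_prime2 p_pr) // => /eqP p3'; rewrite p3' in p3.
Qed.

End Generators.
End CentralExtension.

(** * The second lower central factor *)

Section CommPairs.
Import mathcomp.boot.fintype mathcomp.boot.finset.
Local Open Scope group_scope.
Variable gT : finGroupType.
Implicit Types (E H T : {group gT}) (x y z c : gT).

Lemma head_abelian_type (A : {group gT}) e t :
  abelian_type A = e :: t -> e = exponent A.
Proof.
rewrite /abelian_type -(prednK (cardG_gt0 A)) /=.
by case: ifP => // _ [<- _]; rewrite genGid.
Qed.

Lemma card_joing_cycle T c k : c \in 'N(T) -> c ^+ k \in T -> 0 < k ->
  #|T <*> <[c]>| <= #|T| * k.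
Proof.
move=> nTc Tck k0.
rewrite norm_joinEr ?cycle_subG // -(leq_pmul2r (cardG_gt0 (T :&: <[c]>))).
rewrite -mul_cardG -mulnA leq_mul2l; apply/orP; right.
apply: leq_trans (_ : k * #[c ^+ k] <= _); last first.
  by rewrite leq_mul2l subset_leq_card ?orbT // subsetI !cycle_subG Tck mem_cycle.
rewrite orderXgcd; apply: (@leq_trans (gcdn #[c] k * (#[c] %/ gcdn #[c] k))).
  by rewrite mulnC divnK ?dvdn_gcdl.
by rewrite leq_mul2r dvdn_leq ?dvdn_gcdr ?orbT.
Qed.

(** Modulo L_3(E) the commutator is multiplicative in x. *)
Lemma comm_exp_mod E x y k : x \in E -> y \in E -> [~ x ^+ k, y] \in 'L_3(E) ->
  [~ x, y] ^+ k \in 'L_3(E).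
Proof.
have [N defN] : exists N : {group gT}, N :=: 'L_3(E) by exists 'L_3(E)%G.
rewrite -defN => Ex Ey xky.
have nN : E \subset 'N(N) by rewrite defN lcn_norm.
have [nx ny] := (subsetP nN x Ex, subsetP nN y Ey).
have nxy : [~ x, y] \in 'N(N) by rewrite groupR.
apply: coset_idr; first by rewrite groupX.
rewrite morphX //= morphR // -commXg.
  by rewrite -morphX //= -morphR ?groupX //= coset_id.
apply/commute_sym/commgP/eqP; rewrite /= -!morphR //= coset_id //.
by rewrite defN; apply: mem_commg; rewrite ?mem_commg.
Qed.

Lemma lcn_der_norm E T : 'L_3(E) \subset T -> T \subset E^`(1) -> E \subset 'N(T).
Proof. by move=> sLT sTD; rewrite -commg_subl (subset_trans (commSg _ sTD)). Qed.

Lemma comm_row_bound E T y (k : gT -> nat) (s : seq gT) :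
    'L_3(E) \subset T -> T \subset E^`(1) -> y \in E -> {subset s <= E} ->
    {in s, forall z, 0 < k z /\ [~ y, z] ^+ k z \in 'L_3(E)} ->
  exists T' : {group gT}, [/\ T \subset T', T' \subset E^`(1),
     {in s, forall z, [~ y, z] \in T'} & #|T'| <= #|T| * \prod_(z <- s) k z].
Proof.
move=> sLT sTD Ey; elim: s => [|z s IH] sE ks.
  by exists T; split; rewrite // big_nil muln1.
have [||T1 [sTT1 sT1D sT1 leT1]] := IH.
- by move=> x sx; rewrite sE // inE sx orbT.
- by move=> x sx; apply: ks; rewrite inE sx orbT.
have [kz0 kzL] := ks z (mem_head _ _).
have Ez : z \in E by rewrite sE ?mem_head.
have sLT1 := subset_trans sLT sTT1.
have Dyz : [~ y, z] \in E^`(1) by rewrite mem_commg.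
exists (T1 <*> <[[~ y, z]]>)%G; split.
- exact: subset_trans sTT1 (joing_subl _ _).
- by rewrite join_subG sT1D cycle_subG.
- move=> x; rewrite inE => /predU1P[-> | sx]; apply: subsetP (_ : _ \subset _) _ _.
  + exact: joing_subr.
  + exact: cycle_id.
  + exact: joing_subl.
  + exact: sT1.
rewrite big_cons mulnCA; apply: leq_trans (card_joing_cycle _ (subsetP sLT1 _ kzL) kz0) _.
  by apply: subsetP (subset_trans (der_sub 1 E) (lcn_der_norm sLT1 sT1D)) _ Dyz.
by rewrite mulnC leq_mul2l leT1 orbT.
Qed.

(** The generator [y, z] has order at most minn (o y) (o z), whose square is at most
    o y * o z. Each x occurs in (size s).-1 pairs, hence the exponent. *)
Lemma comm_pairs_bound E (o : gT -> nat) (s : seq gT) : {subset s <= E} ->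
    {in s, forall x, 0 < o x /\ (forall y, y \in E -> [~ x ^+ o x, y] \in 'L_3(E))} ->
  exists T : {group gT}, [/\ 'L_3(E) \subset T, T \subset E^`(1),
     {in s &, forall x y, [~ x, y] \in T}
     & #|T| ^ 2 <= #|'L_3(E)| ^ 2 * (\prod_(x <- s) o x) ^ (size s).-1].
Proof.
elim: s => [|y s IH] sE os.
  exists 'L_3(E)%G; split; rewrite ?muln1 //.
  by rewrite -lcn2 lcn_subS.
have [||T1 [sLT1 sT1D sT1 leT1]] := IH.
- by move=> x sx; rewrite sE // inE sx orbT.
- by move=> x sx; apply: os; rewrite inE sx orbT.
have Ey : y \in E by rewrite sE ?mem_head.
have [oy0 oyL] := os y (mem_head _ _).
have sE' : {subset s <= E} by move=> x sx; rewrite sE // inE sx orbT.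
have os' : {in s, forall z, 0 < minn (o y) (o z) /\
    [~ y, z] ^+ minn (o y) (o z) \in 'L_3(E)}.
  move=> z sz; have [|oz0 ozL] := os z; first by rewrite inE sz orbT.
  rewrite leq_min oy0 oz0; split=> //.
  have Ez := sE' z sz.
  rewrite /minn; case: ltnP => _; first exact: comm_exp_mod (oyL z Ez).
  by rewrite -groupV -expgVn invgR; apply: comm_exp_mod (ozL y Ey).
have [T [sT1T sTD sT leT]] := comm_row_bound sLT1 sT1D Ey sE' os'.
exists T; split=> //; first exact: subset_trans sT1T.
  move=> x z; rewrite !inE => /predU1P[->|sx] /predU1P[->|sz].
  - by rewrite commgg group1.
  - exact: sT.
  - by rewrite -groupV invgR sT.
  - by rewrite (subsetP sT1T) ?sT1.
apply: leq_trans (_ : (#|T1| * \prod_(z <- s) minn (o y) (o z)) ^ 2 <= _).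
  by rewrite leq_exp2r.
rewrite expnMn; apply: leq_trans (leq_mul leT1 (leqnn _)) _.
rewrite -mulnA leq_mul2l; apply/orP; right.
have le2 : (\prod_(z <- s) minn (o y) (o z)) ^ 2 <= o y ^ size s * \prod_(z <- s) o z.
  elim: (s) => [|z s' IHs]; first by rewrite !big_nil.
  rewrite !big_cons /= expnMn [(o y ^ _.+1)%N]expnS mulnACA leq_mul //.
  by rewrite -mulnn leq_mul ?geq_minl ?geq_minr.
apply: leq_trans (leq_mul (leqnn _) le2) _.
rewrite big_cons /= mulnCA -expnSr [X in _ <= X]expnMn leq_mul2l; apply/orP; right.
case: (s) => [|z s'] /=; first by rewrite !big_nil.
by [].
Qed.

End CommPairs.

Section Abelianization.
Import mathcomp.boot.fintype mathcomp.boot.finset.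
Local Open Scope group_scope.
Variables (gT rT : finGroupType) (E : {group gT}) (pi : {morphism E >-> rT}).
Hypothesis central_ker : 'ker pi \subset 'Z(E).
Local Notation G := (pi @* E)%G.

(** Let y be the generator of largest order, exponent Q, in a basis of Q = G / G',
    and s the list of the others. The pairs inside s are counted by comm_pairs_bound
    and the pairs [y, z] cost at most o z each. In total the product of the orders
    in s, which is |Q| / exponent Q, is raised to the power (size s + 1) / 2, and
    size s + 1 is the rank of Q. *)
Lemma card_lcn2_bound : #|'L_2(E)| ^ 2 <=
  #|'L_3(E)| ^ 2 * (#|G / G^`(1)| %/ exponent (G / G^`(1))) ^ 'm(G).
Proof.
set Q := G / G^`(1); have abQ : abelian Q := der_abelian 0 G.
have rQ : 'r(Q) <= 'm(G) by rewrite -grank_abelian // quotient_grank ?der_norm.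
have [b defQ ob] := abelian_structure abQ.
have genQ : << \bigcup_(x <- b) <[x]> >> = Q := bigdprodWY defQ.
have genb : <<[set x in b]>> = Q.
  apply/eqP; rewrite -genQ eqEsubset !gen_subG; apply/andP; split.
    apply/subsetP=> x; rewrite inE => bx; apply: mem_gen.
    by rewrite bigcup_seq; apply/bigcupP; exists x; rewrite ?cycle_id.
  rewrite bigcup_seq; apply/bigcupsP=> x bx.
  by rewrite cycle_subG mem_gen ?inE.
have [ys [ysb ysE genE]] := lift_generating_seq (der_normal 1 G) genb.
pose Y' := (pi @*^-1 G^`(1))%G; have sYE : Y' \subset E by exact: subsetIl.
have YL : [~: Y', E] \subset 'L_3(E).
  have := lcn_preim_comm central_ker 0.
  by rewrite (setIidPr _) // subsetIl.
have YL' : [~: E, Y'] \subset 'L_3(E) by rewrite commGC.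
(* The order of x modulo the preimage Y' of G', which is central modulo L_3(E). *)
pose o x := #[coset G^`(1) (pi x)].
have os : {in ys, forall x,
    0 < o x /\ (forall y, y \in E -> [~ x ^+ o x, y] \in 'L_3(E))}.
  move=> x ysx; split=> [|y Ey]; first exact: order_gt0.
  apply: (subsetP YL); apply: mem_commg => //.
  have Ex := ysE x ysx; apply/morphpreP; split; first exact: groupX.
  have nx : pi x \in 'N(G^`(1)) by apply: (subsetP (der_norm 1 G)); rewrite mem_morphim.
  rewrite morphX //; apply: coset_idr; first exact: groupX.
  by rewrite morphX //= expg_order.
have E'T (T : {group gT}) : T <| E -> 'L_3(E) \subset T ->
    {in ys &, forall x y, [~ x, y] \in T} -> 'L_2(E) \subset T.
  move=> nTE sLT yyT; rewrite lcn2; apply: (der1_generated nTE sYE ysE genE) => //.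
  exact: subset_trans sLT.
have szb : size b = 'r(Q) by rewrite -size_abelian_type // -ob size_map.
have cardQ : #|Q| = (\prod_(x <- ys) o x)%N.
  by rewrite -(bigdprod_card defQ) -ysb big_map.
have szys : size ys = 'r(Q) by rewrite -szb -ysb size_map.
case: ys ysb ysE genE os E'T cardQ szys => [|y s] ysb ysE genE os E'T cardQ szys.
  have le23 : #|'L_2(E)| <= #|'L_3(E)|.
    by apply/subset_leq_card/E'T => //; apply: lcn_normal.
  apply: leq_trans (leq_pmulr _ _); first by rewrite leq_exp2r.
  rewrite expn_gt0 divn_gt0 ?exponent_gt0 // dvdn_leq //; exact: exponent_dvdn.
have oy : o y = exponent Q.
  apply: (head_abelian_type (t := behead (abelian_type Q))).
  by rewrite -ob -ysb.
have sE : {subset s <= E} by move=> x sx; rewrite ysE // inE sx orbT.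
have os' : {in s, forall x,
    0 < o x /\ (forall y, y \in E -> [~ x ^+ o x, y] \in 'L_3(E))}.
  by move=> x sx; apply: os; rewrite inE sx orbT.
have [T [sLT sTD sT leT]] := comm_pairs_bound sE os'.
have Ey : y \in E by rewrite ysE ?mem_head.
have rowP : {in s, forall z, 0 < o z /\ [~ y, z] ^+ o z \in 'L_3(E)}.
  move=> z sz; have [oz0 ozL] := os' z sz; split=> //.
  by rewrite -groupV -expgVn invgR; apply: comm_exp_mod (ozL y Ey); first exact: sE.
have [T' [sTT' sT'D sT' leT']] := comm_row_bound sLT sTD Ey sE rowP.
have sET' : 'L_2(E) \subset T'.
  have sLT' := subset_trans sLT sTT'.
  apply: E'T => //.
    by rewrite /normal (subset_trans sT'D (der_sub 1 E)) (lcn_der_norm sLT' sT'D).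
  move=> x z; rewrite !inE => /predU1P[->|sx] /predU1P[->|sz].
  - by rewrite commgg group1.
  - exact: sT'.
  - by rewrite -groupV invgR sT'.
  - by rewrite (subsetP sTT') ?sT.
have q0 : 0 < \prod_(z <- s) o z.
  by rewrite prodn_gt0 // => z; apply: order_gt0.
rewrite cardQ big_cons oy mulKn ?exponent_gt0 //.
apply: leq_trans (_ : (#|T| * \prod_(z <- s) o z) ^ 2 <= _).
  by rewrite leq_exp2r // (leq_trans _ leT') ?subset_leq_card.
rewrite expnMn; apply: leq_trans (leq_mul leT (leqnn _)) _.
rewrite -mulnA -expnD leq_mul2l; apply/orP; right.
clear -szys q0 rQ.
case: s szys q0 => [|z s] szys q0.
  by rewrite !big_nil !exp1n.
by rewrite leq_pexp2l //; move: rQ; rewrite -szys /=; lia.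
Qed.

End Abelianization.

(** * Bounding the derived subgroup of a central extension *)

Section Bound.
Import mathcomp.boot.fintype mathcomp.boot.finset.
Local Open Scope group_scope.
Variables (gT rT : finGroupType) (E : {group gT}) (pi : {morphism E >-> rT}) (p : nat).
Hypothesis central_ker : 'ker pi \subset 'Z(E).
Hypotheses (p_pr : prime p) (pE : p.-group E).
Local Notation G := (pi @* E)%G.

Lemma card_der1_central_ext : (#|E^`(1) :&: 'ker pi| * #|G^`(1)|)%N = #|E^`(1)|.
Proof.
rewrite -morphim_der // card_morphim (setIidPr (der_sub 1 E)).
by rewrite mulnC -[#|_ : 'ker pi|]indexgI mulnC Lagrange ?subsetIl.
Qed.

(** The product over all j; the lower central series of E ends at 1 because E is a
    p-group. *)
Lemma card_lcn_telescope i delta :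
    (forall j, #|'L_(i + j).+1(E)| <=
       #|'L_(i + j).+2(E)| * #|'L_(i + j)(G) : 'L_(i + j).+1(G)| ^ delta) ->
  #|'L_i.+1(E)| <= #|'L_i(G)| ^ delta.
Proof.
move=> step.
have tele k : #|'L_i.+1(E)| * #|'L_(i + k)(G)| ^ delta <=
    #|'L_(i + k).+1(E)| * #|'L_i(G)| ^ delta.
  elim: k => [|k IH]; first by rewrite addn0.
  have LG : #|'L_(i + k)(G)| =
      (#|'L_(i + k).+1(G)| * #|'L_(i + k)(G) : 'L_(i + k).+1(G)|)%N.
    by rewrite Lagrange ?lcn_subS.
  move: IH (step k); rewrite LG expnMn addnS.
  have: 0 < #|'L_(i + k)(G) : 'L_(i + k).+1(G)| ^ delta.
    by rewrite expn_gt0 indexg_gt0.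
  move: (_ ^ delta)%N => x x0 IH lek; rewrite -(leq_pmul2r x0).
  rewrite -mulnA; apply: leq_trans IH _.
  by rewrite mulnAC leq_mul2r lek orbT.
have nilE : nilpotent E := pgroup_nil pE.
have [n Ln] := lcnP _ nilE.
have L1 : 'L_(i + n).+1(E) = 1.
  by apply/trivgP; rewrite -Ln; apply: lcn_sub_leq; rewrite ltnS leq_addl.
have := tele n; rewrite L1.
rewrite cards1 mul1n; apply: leq_trans.
by rewrite leq_pmulr // expn_gt0 cardG_gt0.
Qed.

(** The factor L_(j+1)(E) / L_(j+2)(E) is controlled by the j-th lower central
    factor of G. The latter multiply up to |G'|^delta, and the savings occur at
    j = 2 and j = 3. *)
Lemma card_der1_ker_bound (delta := 'm(G / 'Z(G))) : p != 3 -> 2 < nil_class G ->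
  (#|E^`(1) :&: 'ker pi| * #|G^`(1)|) ^ 2 * (p ^ (delta - 2 + maxn 1 (delta - 3))) ^ 2 <=
  (#|G / G^`(1)| %/ exponent (G / G^`(1))) ^ 'm(G) * (#|G^`(1)| ^ delta) ^ 2.
Proof.
move=> p3 cG; rewrite card_der1_central_ext.
have nilG : nilpotent G by apply: pgroup_nil (morphim_pgroup _ pE).
have [xs [uxs sz_xs sxE genE]] := lift_min_generators pi.
have step3 := card_lcn3_gain central_ker p_pr pE sxE genE uxs nilG cG.
have step4 := card_lcn4_gain central_ker p_pr pE sxE genE uxs nilG cG.
have step4' := card_lcn4_gain1 central_ker p_pr pE sxE genE uxs nilG cG p3.
have step i := card_lcn_bound central_ker p_pr pE sxE genE i.
have le5 : #|'L_5(E)| <= #|'L_4(G)| ^ delta.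
  by apply: card_lcn_telescope => j; rewrite -[delta]sz_xs; apply: step.
rewrite sz_xs -/delta in step3 step4 step4'.
have {step4 step4'} step4 : #|'L_4(E)| * p ^ maxn 1 (delta - 3) <=
  #|'L_5(E)| * #|'L_3(G) : 'L_4(G)| ^ delta.
  by rewrite /maxn; case: ifP => // _; rewrite expn1.
have LG i : #|'L_i(G)| = (#|'L_i.+1(G)| * #|'L_i(G) : 'L_i.+1(G)|)%N.
  by rewrite Lagrange ?lcn_subS.
have {step4} le4 : #|'L_4(E)| * p ^ maxn 1 (delta - 3) <= #|'L_3(G)| ^ delta.
  by rewrite LG expnMn; apply: leq_trans step4 _; rewrite leq_mul2r le5 orbT.
have {step3} le3 :
    #|'L_3(E)| * p ^ (delta - 2 + maxn 1 (delta - 3)) <= #|'L_2(G)| ^ delta.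
  rewrite LG expnMn expnD mulnA; apply: leq_trans (leq_mul step3 (leqnn _)) _.
  by rewrite mulnAC leq_mul2r le4 orbT.
apply: leq_trans (leq_mul (card_lcn2_bound central_ker) (leqnn _)) _.
by rewrite mulnAC -expnMn mulnC leq_mul2l leq_exp2r // le3 orbT.
Qed.

End Bound.

Import Order.TTheory GRing.Theory Num.Theory.

(** * Group extensions by 2-cocycles *)

Section CocycleExtension.
Local Open Scope group_scope.
Variables gT aT : finGroupType.

Record cocycle := Cocycle {
  cocycle_fun :> gT -> gT -> aT;
  cocycle_mulgC : commutative (@mulg aT);
  cocycleP : forall g h k, cocycle_fun g h * cocycle_fun (g * h) k =
                           cocycle_fun h k * cocycle_fun g (h * k) }.

(** The carrier mentions the cocycle, on which its group law depends. *)
Definition cocycle_ext (c : cocycle) : Type := (gT * aT)%type.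

Variable c : cocycle.
HB.instance Definition _ := Finite.copy (cocycle_ext c) (gT * aT)%type.
Let mulC := cocycle_mulgC c.

Lemma cocycle1g h : c 1 h = c 1 1.
Proof. by have := cocycleP c 1 1 h; rewrite !mul1g => /mulIg. Qed.

Lemma cocycleg1 g : c g 1 = c 1 1.
Proof. by have := cocycleP c g 1 1; rewrite !mulg1 => /mulIg. Qed.

Definition ext_mul (x y : cocycle_ext c) : cocycle_ext c :=
  (x.1 * y.1, x.2 * y.2 * c x.1 y.1).
Definition ext_one : cocycle_ext c := (1, (c 1 1)^-1).
Definition ext_inv (x : cocycle_ext c) : cocycle_ext c :=
  (x.1^-1, (x.2 * c x.1^-1 x.1 * c 1 1)^-1).

Lemma ext_mulA : associative ext_mul.
Proof.
move=> [g a] [h b] [k d]; congr pair; rewrite /= ?mulgA //.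
rewrite -!mulgA; congr (a * (b * _)).
by rewrite -cocycleP !mulgA [d * _]mulC.
Qed.

Lemma ext_mul1 : left_id ext_one ext_mul.
Proof.
by move=> [g a]; congr pair; rewrite /= ?mul1g // cocycle1g mulC mulgA mulgV mul1g.
Qed.

Lemma ext_mulV : left_inverse ext_one ext_inv ext_mul.
Proof.
move=> [g a]; congr pair; rewrite /= ?mulVg //.
by rewrite -mulgA invMg -mulgA mulVg mulg1.
Qed.

HB.instance Definition _ :=
  Finite_isGroup.Build (cocycle_ext c) ext_mulA ext_mul1 ext_mulV.

Definition ext_proj (x : cocycle_ext c) : gT := x.1.
Definition ext_section (g : gT) : cocycle_ext c := (g, 1).
(** The neutral element is (1, (c 1 1)^-1), the cocycle not being normalized; this
    explains the shift. *)
Definition ext_inj (a : aT) : cocycle_ext c := (1, (c 1 1)^-1 * a).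

Lemma ext_mulE (x y : cocycle_ext c) :
  x * y = (x.1 * y.1, x.2 * y.2 * c x.1 y.1) :> gT * aT.
Proof. by []. Qed.

Lemma ext_injM : {morph ext_inj : a b / a * b}.
Proof.
move=> a b; rewrite /ext_inj ext_mulE /= mul1g; congr pair.
by rewrite !mulgA mulC !mulgA mulgV mul1g; congr (_ * _); rewrite mulC.
Qed.

Lemma ext_inj_inj : injective ext_inj.
Proof. by move=> a b [] /mulgI. Qed.

(** The cocycle is the defect of multiplicativity of the section. *)
Lemma ext_sectionM g h :
  ext_section g * ext_section h = ext_inj (c g h) * ext_section (g * h).
Proof.
rewrite !ext_mulE /= mul1g; congr pair; first by rewrite mul1g.
by rewrite mulg1 mul1g cocycle1g mulC mulgA mulgV mul1g.
Qed.

Lemma ext_central a x : ext_proj a = 1 -> commute a x.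
Proof.
case: a x => [g a] [h b] /= ->; rewrite /commute !ext_mulE /= mul1g mulg1.
by congr pair; rewrite cocycle1g cocycleg1 [a * b]mulC.
Qed.

End CocycleExtension.

(** * The central extension defined by the bar resolution *)

Local Open Scope ring_scope.

Section Reduction.
Variables (N : nat) (X : finType).

Definition chain_mod : Type := {ffun X -> 'Z_N}.
HB.instance Definition _ := GRing.Zmodule.on chain_mod.
HB.instance Definition _ := Finite.on chain_mod.
HB.instance Definition _ := [finGroupMixin of chain_mod for +%R].

Definition chain_red (z : chain X) : chain_mod := [ffun x => (z x)%:~R].

Lemma chain_redB z w : chain_red (z - w) = chain_red z - chain_red w.
Proof. by apply/ffunP => x; rewrite !ffunE rmorphB. Qed.

Lemma chain_redD z w : chain_red (z + w) = chain_red z + chain_red w.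
Proof. by apply/ffunP => x; rewrite !ffunE rmorphD. Qed.

Lemma chain_red0 : chain_red 0 = 0.
Proof. by apply/ffunP => x; rewrite !ffunE. Qed.

Lemma chain_red_eq0 z : (1 < N)%N -> chain_red z = 0 -> exists w, z = w *~ N.
Proof.
move=> N1 z0; exists [ffun x => (z x %/ N%:Z)%Z]; apply/ffunP=> x.
rewrite ffunMzE !ffunE -mulrzr intz divzK //.
have := congr1 (fun f : {ffun X -> 'Z_N} => f x) z0; rewrite !ffunE.
have N0 : N%:Z != 0 by rewrite eqz_nat -lt0n ltnW.
rewrite {1}(divz_eq (z x) N) rmorphD rmorphM /=.
rewrite -[in X in _ * X]pmulrn pchar_Zp // mulr0 add0r.
have : (0 <= z x %% N)%Z by rewrite modz_ge0.
have : (z x %% N < N)%Z by rewrite ltz_pmod // ltz_nat ltnW.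
move=> ltN ge0 red0; apply/dvdz_mod0P; move: ltN ge0 red0.
case: (z x %% N)%Z => // r ltN _.
rewrite -pmulrn => /(congr1 val) /=; rewrite val_Zp_nat // modn_small // => ->.
exact: erefl.
Qed.

End Reduction.

Lemma zmod_morphism_chain (X : finType) (V : zmodType) (F : chain X -> V) z :
  zmod_morphism F -> F z = \sum_x F (chain1 x) *~ z x.
Proof.
move=> FB; pose Fa : {additive chain X -> V} :=
  HB.pack F (GRing.isZmodMorphism.Build _ _ F FB).
by rewrite -{1}(chain_ext_id z); exact: (raddf_chain_ext _ Fa).
Qed.

Lemma sum_chain1 (X : finType) (V : zmodType) (f : X -> V) x :
  \sum_y f y *~ chain1 x y = f x.
Proof.
rewrite (bigD1 x) //= ffunE eqxx mulr1z big1 ?addr0 // => y /negPf.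
by rewrite ffunE => ->; rewrite mulr0z.
Qed.

Section AbelianGroupZmodule.
Variables (qT : finGroupType) (qC : commutative (@mulg qT)).
(** A commutative group in additive notation, so that integer combinations of its
    elements can be formed. *)
Definition zmod_of_group of commutative (@mulg qT) : Type := qT.
HB.instance Definition _ := Finite.on (zmod_of_group qC).
HB.instance Definition _ := GRing.isZmodule.Build (zmod_of_group qC)
  (@mulgA qT) qC (@mul1g qT) (@mulVg qT).
End AbelianGroupZmodule.

Section UniversalExtension.
Variable hT : finGroupType.
Local Notation chain2 := (chain (hT * hT)%type).
Local Notation N := #|hT|.

(** Cosets of this subgroup form the kernel of the extension. *)
Definition boundaries_mod : {set chain_mod N (hT * hT)%type} :=
  [set v | `[< exists w, v = chain_red N (bar_d3 w) >]].

Lemma boundaries_modP v :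
  reflect (exists w, v = chain_red N (bar_d3 w)) (v \in boundaries_mod).
Proof. by rewrite inE; apply: asboolP. Qed.

Lemma group_set_boundaries_mod : group_set boundaries_mod.
Proof.
apply/group_setP; split.
  by apply/boundaries_modP; exists 0; rewrite raddf0 chain_red0.
move=> _ _ /boundaries_modP[u ->] /boundaries_modP[v ->].
by apply/boundaries_modP; exists (u + v); rewrite raddfD chain_redD.
Qed.
Canonical boundaries_mod_group := Group group_set_boundaries_mod.

Lemma norm_boundaries_mod v : v \in 'N(boundaries_mod)%g.
Proof.
have ab : abelian [set: chain_mod N (hT * hT)%type].
  by apply/centsP=> x _ y _; apply: addrC.
by rewrite (fintype.subsetP (sub_abelian_norm ab (finset.subsetT _))) ?inE.
Qed.

Definition chain_class (z : chain2) : coset_of boundaries_mod :=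
  coset boundaries_mod (chain_red N z).

Lemma chain_classB z w : chain_class (z - w) = (chain_class z * (chain_class w)^-1)%g.
Proof.
by rewrite /chain_class chain_redB morphM ?morphV ?norm_boundaries_mod.
Qed.

Lemma chain_classD z w : chain_class (z + w) = (chain_class z * chain_class w)%g.
Proof.
by rewrite /chain_class chain_redD morphM ?norm_boundaries_mod.
Qed.

Lemma chain_class_mulgC : commutative (@mulg (coset_of boundaries_mod)).
Proof.
move=> a b; have [u _ ->] := cosetP a; have [v _ ->] := cosetP b.
by rewrite -!morphM ?norm_boundaries_mod //; congr (coset _ _); apply: addrC.
Qed.

Lemma chain_class_boundary w : chain_class (bar_d3 w) = 1%g.
Proof. by apply: coset_id; apply/boundaries_modP; exists w. Qed.

(** If z = d3 w + N y, then N y is a cycle, hence so is y, chains being torsion-free;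
    and N y is a boundary because N = |hT| annihilates the homology. *)
Lemma chain_class_eq1 z : (1 < N)%N -> cycles2 hT z -> chain_class z = 1%g ->
  boundaries2 hT z.
Proof.
move=> N1 Zz /(coset_idr (norm_boundaries_mod _))/boundaries_modP[w zw].
have [|y yE] := @chain_red_eq0 N _ (z - bar_d3 w) N1.
  by rewrite chain_redB zw subrr.
have y0 : bar_d2 y = 0.
  have : bar_d2 y *~ N = 0 by rewrite -raddfMz -yE raddfB /= Zz bar_d2_d3 subrr.
  move/ffunP => yn; apply/ffunP => x; move: (yn x); rewrite ffunMzE !ffunE.
  by move/eqP; rewrite mulrz_eq0 eqz_nat -[_ == 0%N]negbK -lt0n ltnW //= => /eqP.
have [v vE] := bar_homotopy y0; exists (v + w) => //.
by rewrite raddfD /= vE -yE subrK.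
Qed.

(** The cocycle identity is the boundary of [g|h|k]. *)
Lemma chain_cocycleP (g h k : hT) :
  (chain_class (chain1 (g, h)) * chain_class (chain1 (g * h, k)) =
   chain_class (chain1 (h, k)) * chain_class (chain1 (g, h * k)))%g.
Proof.
rewrite -!chain_classD; apply/eqP; rewrite eq_sym eq_mulgV1 -chain_classB.
rewrite -(chain_class_boundary (chain1 (g, h, k))) bar_d3_1; apply/eqP; congr chain_class.
by apply/ffunP => x; rewrite !ffunE; ring.
Qed.

Definition bar_cocycle := Cocycle chain_class_mulgC chain_cocycleP.
Local Notation ET := (cocycle_ext bar_cocycle).

(** Modulo the derived subgroup, [g|h] becomes s(g) + s(h) - s(gh), that is, the
    image of d2 [g|h] under the additive map extending s. By additivity the class of
    z is the image of d2 z, which vanishes for a cycle. *)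
Lemma ext_inj_cycle_der1 z : cycles2 hT z ->
  ext_inj bar_cocycle (chain_class z) \in [set: ET]^`(1)%g.
Proof.
set D := ([set: ET]^`(1))%G => Zz.
have nD x : x \in 'N(D)%g by rewrite (fintype.subsetP (der_norm 1 _)) ?inE.
have qC : commutative (@mulg (coset_of D)).
  move=> a b; have [x _ ->] := cosetP a; have [y _ ->] := cosetP b.
  apply: (centsP (der_abelian 0 [set: ET])); rewrite mem_quotient ?inE //.
pose phi g : zmod_of_group qC := coset D (ext_section bar_cocycle g).
pose F1 z : zmod_of_group qC := coset D (ext_inj bar_cocycle (chain_class z)).
pose F2 (w : chain hT) := \sum_g phi g *~ w g.
have F1D u v : F1 (u + v) = F1 u + F1 v.
  by rewrite /F1 chain_classD ext_injM morphM.
have F1B : zmod_morphism F1.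
  by move=> u v; apply/eqP; rewrite eq_sym subr_eq -F1D subrK.
have F2B : zmod_morphism F2.
  move=> u v; rewrite -sumrB; apply: eq_bigr => g _.
  by rewrite !ffunE mulrzBr.
have F2D u v : F2 (u + v) = F2 u + F2 v.
  by rewrite -{2}(addrK v u) F2B subrK.
have F2_1 g : F2 (chain1 g) = phi g.
  exact: sum_chain1.
have F1_1 g h : F1 (chain1 (g, h)) = phi h - phi (g * h)%g + phi g.
  have : phi g + phi h = F1 (chain1 (g, h)) + phi (g * h)%g.
    have := congr1 (coset D) (ext_sectionM bar_cocycle g h).
    by rewrite !morphM.
  by move=> e; apply: (addIr (phi (g * h)%g)); rewrite -e addrAC subrK addrC.
have F12 w : F1 w = F2 (bar_d2 w).
  have F2dB : zmod_morphism (fun v : chain2 => F2 (bar_d2 v)).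
    by move=> u v; rewrite raddfB F2B.
  rewrite (zmod_morphism_chain w F1B) [RHS](zmod_morphism_chain w F2dB).
  apply: eq_bigr => -[g h] _; congr (_ *~ _).
  by rewrite /= bar_d2_1 F2D F2B !F2_1 F1_1.
apply: (coset_idr (nD _)); change (F1 z = 0).
by rewrite F12 Zz -(subrr 0) F2B subrr.
Qed.

End UniversalExtension.

(** * The bound on the Schur multiplier *)

(** Sending a homology class to the class of a representing cycle is injective,
    by chain_class_eq1. *)
Lemma card_H2_le_cycles (hT : finGroupType) (D : {set cocycle_ext (bar_cocycle hT)}) :
    (1 < #|hT|)%N ->
    (forall z, cycles2 hT z -> ext_inj (bar_cocycle hT) (chain_class z) \in D) ->
  (#|` fset_set (H2 hT)| <= #|D|)%N.
Proof.
move=> N1 zD.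
pose cls (z : chain (hT * hT)%type) := [set z + b | b in boundaries2 hT]%classic.
pose rep S := xget 0 [set z | cycles2 hT z /\ cls z = S]%classic.
have repP S : H2 hT S -> cycles2 hT (rep S) /\ cls (rep S) = S.
  move=> [z Zz zS]; apply: (@xgetPex _ 0 [set z | cycles2 hT z /\ cls z = S]%classic).
  by exists z.
pose f S := ext_inj (bar_cocycle hT) (chain_class (rep S)).
have fin := H2_finite hT.
rewrite cardE -(size_map f); apply: uniq_leq_size.
  rewrite map_inj_in_uniq ?fset_uniq // => S T.
  rewrite !in_fset_set // => /set_mem/repP[ZS eS] /set_mem/repP[ZT eT].
  move/(@ext_inj_inj _ _ _) => eqST; rewrite -eS -eT.
  have [w _ wE] : boundaries2 hT (rep S - rep T).
    apply: chain_class_eq1 => //.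
      apply: etrans (raddfB _ _ _) _; apply/eqP; rewrite subr_eq0; apply/eqP.
      exact: etrans ZS (esym ZT).
    by rewrite chain_classB eqST mulgV.
  have -> : rep S = rep T + bar_d3 w by rewrite wE addrC subrK.
  apply/seteqP; split=> _ [_ [v _ <-] <-] /=.
    by exists (bar_d3 (w + v)); [exists (w + v) | rewrite raddfD addrA].
  exists (bar_d3 (v - w)); first by exists (v - w).
  by rewrite raddfB /= addrA addrAC addrK addrC.
move=> x /mapP[S]; rewrite in_fset_set // => /set_mem/repP[ZS _] ->.
by rewrite mem_enum zD.
Qed.

Lemma card_ext_of (hT : finGroupType) :
  #|[set: cocycle_ext (bar_cocycle hT)]| =
  (#|hT| * #|[set: coset_of (boundaries_mod hT)]|)%N.
Proof. by rewrite !cardsT card_prod. Qed.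

Lemma coset_boundaries_pgroup (hT : finGroupType) p : (1 < #|hT|)%N ->
  (p.-group [set: hT])%g -> (p.-group [set: coset_of (boundaries_mod hT)])%g.
Proof.
move=> N1 pH.
have -> : [set: coset_of (boundaries_mod hT)] =
    ([set: chain_mod #|hT| (hT * hT)%type] / boundaries_mod hT)%g.
  apply/setP=> a; rewrite inE; have [x _ ->] := cosetP a.
  by rewrite mem_quotient ?inE.
apply: quotient_pgroup; rewrite /pgroup cardsT card_ffun card_ord Zp_cast //.
rewrite pnatX; apply/orP; left; rewrite -cardsT; exact: pH.
Qed.

Lemma schur_multiplier_ext (gT : finGroupType) (G : {group gT}) p :
  (p.-group G)%g -> (G :!=: 1)%g ->
  exists (eT : finGroupType) (E : {group eT}) (pi : {morphism E >-> gT}),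
    [/\ (p.-group E)%g, ('ker pi \subset 'Z(E))%g, (pi @* E)%g = G
      & (#|` fset_set (schur_multiplier G)| <= #|(E^`(1) :&: 'ker pi)%g|)%N].
Proof.
move=> pG ntG; pose hT := subg_of G.
have cardh : #|hT| = #|G| by rewrite (card_isog (isog_subg G)) cardsT.
have N1 : (1 < #|hT|)%N by rewrite cardh cardG_gt1.
have pH : (p.-group [set: hT])%g by rewrite /pgroup cardsT cardh.
pose eT : finGroupType := cocycle_ext (bar_cocycle hT).
pose E := [set: eT]%G.
pose f (x : eT) : gT := sgval (ext_proj x).
have fM : {in E &, {morph f : x y / (x * y)%g}} by move=> x y _ _.
pose pi := Morphism fM.
have kerP' x : (x \in ('ker pi)%g) = (ext_proj x == 1%g).
  have Ex : x \in E by rewrite inE.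
  by apply/(kerP pi Ex)/eqP=> [fx|fx]; [apply: val_inj | rewrite /= /f fx].
exists eT, E, pi; split.
- rewrite /pgroup card_ext_of pnatM; apply/andP; split; first by rewrite cardh.
  exact: coset_boundaries_pgroup.
- apply/fintype.subsetP=> x; rewrite kerP' => /eqP px; apply/centerP.
  split; first by rewrite inE.
  by move=> y _; apply: ext_central.
- apply/setP=> g; apply/morphimP/idP=> [[x _ _ ->]|Gg]; first exact: subgP.
  by exists (ext_section (bar_cocycle hT) (subg G g)); rewrite ?inE //= /f /= subgK.
apply: card_H2_le_cycles => // z Zz; rewrite inE ext_inj_cycle_der1 // kerP'.
exact: eqxx.
Qed.

(** Passage from an inequality between squares of natural numbers to real exponents;
    squaring absorbs the half-integer d (m - e) / 2. *)
Lemma powR_bound (R : realType) (p M s d e m n delta : nat) : (1 < p)%N ->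
    (e <= m)%N -> (m <= n)%N ->
    ((M * p ^ (n - m)) ^ 2 * (p ^ s) ^ 2 <=
     (p ^ (m - e)) ^ d * ((p ^ (n - m)) ^ delta) ^ 2)%N ->
  M%:R <= p%:R `^ (d%:R * (m%:R - e%:R) / 2 + (delta%:R - 1) * (n%:R - m%:R) - s%:R) :> R.
Proof.
move=> p1 em mn le2; set x := (X in _ `^ X).
have p0 : (0 : R) < p%:R by rewrite ltr0n ltnW.
have pn0 : (p%:R : R) != 0 by rewrite gt_eqF.
rewrite -(@ler_pXn2r _ 2) ?nnegrE ?powR_ge0 //.
have pos : (0 : R) < p%:R `^ (2 * (n - m + s))%:R by rewrite powR_gt0.
have -> : (p%:R `^ x) ^+ 2 = p%:R `^ (x * 2%:R) by rewrite powRrM powR_mulrn ?powR_ge0.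
rewrite -(ler_pM2r pos) -powRD; last by rewrite pn0 implybT.
have -> : x * 2%:R + (2 * (n - m + s))%:R = (d * (m - e) + delta * (n - m) * 2)%:R.
  by rewrite /x !(natrD, natrM, natrB) //; field.
rewrite !powR_mulrn ?(ltW p0) // -!natrX -natrM ler_nat.
move: le2; rewrite !expnMn -!expnM -!expnD => le2.
have -> : (d * (m - e) + delta * (n - m) * 2 =
           (m - e) * d + (n - m) * (delta * 2))%N by lia.
apply: leq_trans le2; rewrite -mulnA -expnD.
by rewrite (_ : 2 * (n - m + s) = (n - m) * 2 + s * 2)%N //; lia.
Qed.

Theorem theorem4p3 (R : realType) (gT : finGroupType) (G : {group gT})
    (p n c d delta m e : nat) :
  prime p -> p <> 2%N -> p <> 3%N ->
  #|G| = (p ^ n)%N ->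
  c = nil_class G -> (3 <= c)%N ->
  d = 'm(G)%g -> delta = 'm(G / 'Z(G))%g ->
  #|(G / G^`(1))%g| = (p ^ m)%N ->
  exponent (G / G^`(1))%g = (p ^ e)%N ->
  (#|` fset_set (schur_multiplier G)|)%:R <=
    p%:R `^ (d%:R * (m%:R - e%:R) / 2 + (delta%:R - 1) * (n%:R - m%:R)
             - Num.max 0 (delta%:R - 2) - Num.max 1 (delta%:R - 3)) :> R.
Proof.
move=> p_pr _ p3 cardG -> class3 -> -> cardQ expQ.
have p1 := prime_gt1 p_pr.
have pG : (p.-group G)%g by rewrite /pgroup cardG pnatX pnat_id.
have ntG : (G :!=: 1)%g by rewrite -nil_class0 -lt0n (leq_trans _ class3).
have [eT [E [pi [pE central_ker imE leM]]]] := schur_multiplier_ext pG ntG.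
have imEG : (pi @* E)%G = G by apply: group_inj.
have := card_der1_ker_bound central_ker p_pr pE; rewrite imEG.
move=> /(_ (introN eqP p3) class3); rewrite cardQ expQ.
have em : (e <= m)%N.
  rewrite -(leq_exp2l _ _ p1) -expQ -cardQ.
  by apply: dvdn_leq (exponent_dvdn _); rewrite cardQ expn_gt0 prime_gt0.
have [mn cardG'] : (m <= n)%N /\ #|(G^`(1))%g| = (p ^ (n - m))%N.
  have := Lagrange (der_sub 1 G).
  rewrite -(card_quotient (der_norm 1 G)) cardQ cardG => cardM.
  have mn : (m <= n)%N.
    by rewrite -(leq_exp2l _ _ p1) -cardM leq_pmull.
  split=> //; apply/eqP; rewrite -(eqn_pmul2r (_ : 0 < p ^ m)%N) ?expn_gt0 ?prime_gt0 //.
  by rewrite cardM -expnD subnK.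
rewrite cardG' -expnB ?prime_gt0 // => bound.
set delta' := 'm(G / 'Z(G))%g in bound *.
have maxE : (delta' - 2 + maxn 1 (delta' - 3))%:R =
    Num.max 0 (delta'%:R - 2) + Num.max 1 (delta'%:R - 3) :> R.
  rewrite natrD; congr (_ + _).
    case: (leqP 2 delta') => le2; first by rewrite natrB // max_r // subr_ge0 ler_nat.
    rewrite (eqP (ltnW le2 : delta' - 2 == 0)%N) max_l // subr_le0 ler_nat.
    exact: ltnW.
  case: (leqP 4 delta') => le4.
    rewrite (_ : maxn 1 (delta' - 3) = delta' - 3)%N; last lia.
    rewrite natrB; last lia.
    by rewrite max_r // lerBrDr -(natrD R 1 3) ler_nat.
  rewrite (_ : maxn 1 (delta' - 3) = 1)%N; last lia.
  by rewrite max_l // lerBlDr -(natrD R 1 3) ler_nat; lia.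
apply: le_trans (_ : #|(E^`(1) :&: 'ker pi)%g|%:R <= _); first by rewrite ler_nat.
have := powR_bound R p1 em mn bound.
by rewrite maxE opprD addrA.
Qed.
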